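(* Let $d=1$, $V\in\ell^2L^1(\mathbb R)$ and $N\gg1$ (i.e. $N\in\mathbb N$ sufficiently large). For any $\eta>0$ there exists a sequence $(x_j)_{j=1}^N$, $x_j=x_j(\eta,\|V\|_{\ell^2L^1})$, such that $$\sum_{\operatorname{Im}\sqrt{z_j}>(d+1)\eta}\mathrm{dist}(z_j,\mathbb R_+)\lesssim N\sum_{j=1}^N\Big(\int_{\mathbb R}|V_j|\,\mathrm dx\Big)^2,$$ where the sum on the left runs over the discrete eigenvalues $z_j$ of $H_V$ with $\operatorname{Im}\sqrt{z_j}>(d+1)\eta$.
   Context: Setting: $V=\sum_{j=1}^NV_j$ on $\mathbb R$, where the complex-valued $V_j$ have mutually disjoint supports, and they are regarded as given only up to translations: $V_j(x)=W_j(x-x_j)$, with given profiles $W_j$ whose support contains the origin and points $x_j\in\mathbb R$ to be chosen. $\|V\|_{\ell^2L^1}=\big(\sum_{j=1}^N\|V_j\|_{L^1(\mathbb R)}^2\big)^{1/2}=\big(\sum_{j=1}^N\|W_j\|_{L^1(\mathbb R)}^2\big)^{1/2}$ does not depend on the $x_j$. $H_V=-\partial_x^2+V$ is the $m$-sectorial operator in $L^2(\mathbb R)$; a discrete eigenvalue is an isolated point of the spectrum that is an eigenvalue of finite multiplicity, and eigenvalues are counted according to algebraic multiplicity. The square root on $\mathbb C\setminus[0,\infty)$ has the branch with $\operatorname{Im}\sqrt z>0$. $\mathbb R_+=[0,\infty)$. $a\lesssim b$ means $|a|\leq C|b|$ with an absolute constant $C$. *)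

(* Defs.v *)
From HB Require Import structures.
From mathcomp Require Import all_boot all_order all_algebra.
From mathcomp Require Import all_classical all_reals all_analysis.
From mathcomp Require Export complex.

Set Implicit Arguments.
Unset Strict Implicit.
Unset Printing Implicit Defensive.

Import Order.TTheory GRing.Theory Num.Theory.
Import numFieldNormedType.Exports.
Import Normc.

Local Open Scope classical_set_scope.
Local Open Scope ring_scope.
Local Open Scope complex_scope.

Section Functions.
Variable R : realType.
Notation mu := (@lebesgue_measure R).
Implicit Types f u v : R -> R[i].

Definition isLp (p : \bar R) f : Prop :=
  (fun t => complex.Re (f t)) \in Lfun mu p /\
  (fun t => complex.Im (f t)) \in Lfun mu p.

Definition cintegral (D : set R) f : R[i] :=
  (\int[mu]_(t in D) complex.Re (f t)) +i*
  (\int[mu]_(t in D) complex.Im (f t)).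

Definition L1norm f : R := \int[mu]_t normc (f t).

Definition L2norm f : R := Num.sqrt (\int[mu]_t normc (f t) ^+ 2).

(* The closed support of an element of L^1: the complement of the largest open
   set on which it vanishes almost everywhere. *)
Definition esupport f : set R :=
  [set t | forall U, nbhs t U -> ~ mu.-negligible (U `&` [set s | f s != 0])].

(* u is the absolutely continuous representative of an element of H^1(R), and
   its weak derivative is u'. *)
Definition isH1 u u' : Prop :=
  [/\ isLp 2%:E u, isLp 2%:E u' &
      forall a b : R, a <= b -> u b - u a = cintegral `[a, b] u'].

Definition l2L1norm (N : nat) (W : 'I_N -> R -> R[i]) : R :=
  Num.sqrt (\sum_(j < N) L1norm (W j) ^+ 2).

Definition translate f (a : R) : R -> R[i] := fun t => f (t - a).

End Functions.

Section Schroedinger.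
Variables (R : realType) (V : R -> R[i]).
Notation mu := (@lebesgue_measure R).
Implicit Types (u f : R -> R[i]) (z : R[i]).

(* Graph of H_V, up to equality almost everywhere. H_V is the operator
   associated by Kato's first representation theorem with the closed sectorial
   form h[u, v] = \int u' conj(v') + \int V u conj(v) with domain H^1(R): u lies
   in its domain and H_V u = f iff u \in H^1, f \in L^2 and h[u, v] = <f, v> for
   every v \in H^1. *)
Definition HV u f : Prop :=
  isLp 2%:E f /\
  exists u0 u0' : R -> R[i],
    [/\ u = u0 %[ae mu], isLp 2%:E u, isH1 u0 u0' &
      forall v v' : R -> R[i], isH1 v v' ->
        cintegral setT (fun t => u0' t * (v' t)^*) +
        cintegral setT (fun t => V t * u0 t * (v t)^*) =
        cintegral setT (fun t => f t * (v t)^*)].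

Definition HVsub z u f : Prop := HV u (fun t => f t + z * u t).

(* z is in the resolvent set: H_V - z is a bijection from its domain onto L^2
   whose inverse is bounded. *)
Definition resolvent_set : set R[i] := [set z |
  exists c : R, forall f, isLp 2%:E f ->
    exists u, [/\ HVsub z u f,
                  forall w, HVsub z w f -> w = u %[ae mu] &
                  L2norm u <= c * L2norm f]].

Definition spectrum : set R[i] := ~` resolvent_set.

Definition eigenvalue z : Prop :=
  exists2 u, ~ (u = cst 0 %[ae mu]) & HVsub z u (cst 0).

Fixpoint ker_pow z (k : nat) u : Prop :=
  if k is k'.+1 then exists2 w, HVsub z u w & ker_pow z k' w
  else isLp 2%:E u /\ u = cst 0 %[ae mu].

Definition lin_indep (n : nat) (u : 'I_n -> R -> R[i]) : Prop :=
  forall c : 'I_n -> R[i],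
    (fun t => \sum_(i < n) c i * u i t) = cst 0 %[ae mu] ->
    forall i, c i = 0.

(* Dimension (possibly infinite) of the root space \bigcup_k ker (H_V - z)^k. *)
Definition alg_mult z : \bar R :=
  ereal_sup [set n%:R%:E | n in [set n : nat |
    exists2 u : 'I_n -> R -> R[i],
      (forall i, exists k, ker_pow z k (u i)) & lin_indep u]].

(* R[i]^o carries the topology of the norm. *)
Definition discrete_eigenvalue z : Prop :=
  [/\ isolated (spectrum : set R[i]^o) z, eigenvalue z & (alg_mult z < +oo)%E].

End Schroedinger.

Definition dist_Rplus (R : realType) (z : R[i]) : R :=
  inf [set normc (z - t%:C) | t in [set t : R | 0 <= t]].

(* Main.v *)
(* Any points [y j] separating the supports will do.  With B = ||V||_1, the
   Cauchy-Schwarz inequality gives B^2 <= N sum_j ||V_j||_1^2, so it is enough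
   to prove that the sum over eigenvalues is at most 2 B^2.

   Testing the weak equation against exp(ik|x-y|) gives, for (H_V - k^2) u = f
   and Im k > 0, the bound (2|k| - B) sup|u| <= ||f||_2 / sqrt(Im k).  With f = 0
   every eigenvalue satisfies |z| <= B^2/4; with k = iB the operator
   T = (H_V + B^2)^-1 satisfies sup|T f| <= B^(-3/2) ||f||_2.

   On the finite-dimensional span of finitely many root vectors choose an
   orthonormal Schur basis e_i of T, put w_i = T e_i and let
   mu_i = <w_i, e_i> = 1/(z_i + B^2) be the diagonal entries.  Testing the
   equation of w_i against w_i yields conj(mu_i) = p_i + eps_i with
   p_i >= B^2 ||w_i||^2 >= B^2 |mu_i|^2 and eps_i = int V |w_i|^2, which amounts to
   dist(z_i, R_+) <= |z_i + B^2|^2 |eps_i|.  By duality the sup bound for T gives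
   sum_i |w_i(x)|^2 <= B^(-3) for every x, whence sum_i |eps_i| <= B^(-2). *)

Require Import Defs.
From HB Require Import structures.
From mathcomp Require Import all_boot all_order all_algebra.
From mathcomp Require Import all_classical all_reals all_analysis.
From mathcomp Require Import measurable_realfun spectral mxred ring lra.

Set Implicit Arguments.
Unset Strict Implicit.
Unset Printing Implicit Defensive.

Import Order.TTheory GRing.Theory Num.Theory.
Import numFieldNormedType.Exports.
Import Normc.

Local Open Scope classical_set_scope.
Local Open Scope ring_scope.
Local Open Scope complex_scope.

(** * Integration on the line *)

Section RealIntegration.
Variable R : realType.
Notation mu := (@lebesgue_measure R).
Implicit Types (f g : R -> R) (D : set R).

(** [HV] is only a relation between functions, so [T] is never built on all of L^2. It is defined on
    the span of complete chains of root vectors: if (H_V - z) c = c', then T c = (c - T c') / (z -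
    z0) with z0 = -B^2, so the span is invariant, and the sup bound at f = 0 makes T single-valued
    there. Since H_V is not normal, root vectors need be neither orthogonal nor eigenvectors. A
    Schur basis is orthonormal, as the duality step requires, and its triangular matrix still shows
    each 1/(z - z0) on the diagonal at least as often as the multiplicity of z.

    The base point -B^2 stays clear of the disc |z| <= B^2/4, and there 2|k| - B is B itself. From
    |z + B^2| <= 5B^2/4 comes the constant 25/16, rounded up to 2.

    H^1 functions are merely absolutely continuous, so integration by parts against exponentials is
    derived from Fubini on a triangle. The Green kernel then serves twice: for the Sobolev bound,
    which makes suprema finite, and for the resolvent estimate, where the potential term is absorbed
    into the left side. *)

Definition rintble D f := mu.-integrable D (EFin \o f).

Lemma rintble_dom D f g : measurable D -> measurable_fun setT f ->
  rintble D g -> (forall t, D t -> `|f t| <= g t) -> rintble D f.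
Proof.
move=> mD mf ig fg; apply: (@le_integrable _ _ _ mu D mD (EFin \o f) (EFin \o g)) => //.
  by apply/measurable_EFinP; exact: measurable_funTS.
move=> t Dt /=; rewrite lee_fin.
by rewrite (le_trans (fg _ Dt))// ler_norm.
Qed.

Lemma rintbleD D f g : measurable D -> rintble D f -> rintble D g ->
  rintble D (fun t => f t + g t).
Proof. by move=> mD hf hg; exact: (@integrableD _ _ _ mu D mD (EFin \o f) (EFin \o g)). Qed.

Lemma rintbleB D f g : measurable D -> rintble D f -> rintble D g ->
  rintble D (fun t => f t - g t).
Proof. by move=> mD hf hg; exact: (@integrableB _ _ _ mu D mD (EFin \o f) (EFin \o g)). Qed.

Lemma rintbleZ D f r : measurable D -> rintble D f -> rintble D (fun t => r * f t).
Proof. by move=> mD hf; exact: (@integrableZl _ _ _ mu D mD r (EFin \o f)). Qed.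

Lemma rintbleS D D' f : measurable D -> measurable D' -> D' `<=` D ->
  rintble D f -> rintble D' f.
Proof. by move=> mD mD' s; exact: integrableS. Qed.

(** A deduction rule for equalities almost everywhere. Fed with [ae_eqxx], it also turns an identity
    at every point into one almost everywhere. *)
Lemma ae_eq_mono (U U' : Type) (u v : R -> U) (u' v' : R -> U') :
  u = v %[ae mu] -> (forall t, u t = v t -> u' t = v' t) -> u' = v' %[ae mu].
Proof.
move=> uv h; apply: negligibleS uv => t /= nt; apply: contra_not nt => e _.
by apply: h; exact: e.
Qed.

Lemma ae_eq_mono2 (U U' U2 : Type) (u v : R -> U) (u' v' : R -> U') (u2 v2 : R -> U2) :
  u = v %[ae mu] -> u' = v' %[ae mu] ->
  (forall t, u t = v t -> u' t = v' t -> u2 t = v2 t) -> u2 = v2 %[ae mu].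
Proof.
move=> uv uv' h; apply: negligibleS (negligibleU uv uv') => t /= nt.
rewrite -not_andE; apply: contra_not nt => -[e e'] _.
by apply: h; [exact: e|exact: e'].
Qed.

Lemma ae_eqxx (U : Type) (u : R -> U) : u = u %[ae mu].
Proof. by rewrite /prop_near1 /= /nbhs /= /almost_everywhere;
  apply: negligibleS (negligible_set0 _) => t /=; apply. Qed.

Lemma Rintegral_ge0_eq0 f : measurable_fun setT f -> rintble setT f ->
  (forall t, 0 <= f t) -> \int[mu]_t f t = 0 -> f = cst 0 %[ae mu].
Proof.
move=> mf intf f0 If.
have H : (\int[mu]_t `|(f t)%:E| = 0)%E.
  under eq_integral do rewrite gee0_abs ?lee_fin//.
  by rewrite -(fineK (integrable_fin_num measurableT intf)) -[fine _]/(\int[mu]_t f t) If.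
have mf' : measurable_fun setT (EFin \o f) by exact/measurable_EFinP.
have [+ _] := @ae_eq_integral_abs _ _ R mu setT measurableT (EFin \o f) mf'.
move=> /(_ H).
by move=> h; apply: (ae_eq_mono h) => t /= [].
Qed.

Lemma Rintegral_ae_eq f g : measurable_fun setT f -> measurable_fun setT g ->
  f = g %[ae mu] -> \int[mu]_t f t = \int[mu]_t g t.
Proof.
move=> mf mg fg; congr fine; apply: ae_eq_integral => //.
- exact/measurable_EFinP.
- exact/measurable_EFinP.
- by apply: (ae_eq_mono fg) => t /= ->.
Qed.

(** The algebraic core of the Cauchy-Schwarz inequality: a quadratic without sign change has
    nonpositive discriminant. *)
Lemma discriminant_le (a b c : R) : 0 <= a -> 0 <= b ->
  (forall t, 0 <= a * t ^+ 2 - 2 * c * t + b) -> c <= Num.sqrt a * Num.sqrt b.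
Proof.
move=> a0 b0 H; have [c0|c0] := leP c 0.
  by rewrite (le_trans c0)// mulr_ge0// sqrtr_ge0.
rewrite -sqrtrM// -[leLHS](ger0_norm (ltW c0)) -sqrtr_sqr ler_wsqrtr//.
move: a0; rewrite le_eqVlt => /orP[/eqP a0|a0].
  (* With [a = 0] the polynomial is affine, and at this point it takes the value -1. *)
  have := H ((b + 1) / (2 * c)); rewrite -a0 mul0r add0r.
  have -> : 2 * c * ((b + 1) / (2 * c)) = b + 1 by field; rewrite gt_eqF.
  by lra.
(* The minimum of the parabola is at [c / a]. *)
have := H (c / a); have -> : a * (c / a) ^+ 2 - 2 * c * (c / a) + b = (a * b - c ^+ 2) / a.
  by field; rewrite gt_eqF.
by rewrite pmulr_lge0 ?invr_gt0// subr_ge0.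
Qed.

Lemma rintble_mul D f g : measurable D -> measurable_fun setT f -> measurable_fun setT g ->
  rintble D (fun t => f t ^+ 2) -> rintble D (fun t => g t ^+ 2) ->
  rintble D (fun t => f t * g t).
Proof.
move=> mD mf mg f2 g2; apply: (@rintble_dom _ _ (fun t => f t ^+ 2 + g t ^+ 2)) => //.
- exact: measurable_funM.
- exact: rintbleD.
- move=> t _; rewrite normrM -(real_normK (num_real (f t))) -(real_normK (num_real (g t))).
  by have := normr_ge0 (f t); have := normr_ge0 (g t); nra.
Qed.

Lemma Rcauchy_schwarz f g : measurable_fun setT f -> measurable_fun setT g ->
  rintble setT (fun t => f t ^+ 2) -> rintble setT (fun t => g t ^+ 2) ->
  \int[mu]_t (f t * g t) <=
    Num.sqrt (\int[mu]_t f t ^+ 2) * Num.sqrt (\int[mu]_t g t ^+ 2).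
Proof.
move=> mf mg f2 g2; have fg := rintble_mul measurableT mf mg f2 g2.
apply: discriminant_le; try by apply: Rintegral_ge0 => t _; rewrite sqr_ge0.
move=> s.
have -> : (\int[mu]_t f t ^+ 2) * s ^+ 2 - 2 * (\int[mu]_t
  (f t * g t)) * s + \int[mu]_t g t ^+ 2
  = \int[mu]_t (s * f t - g t) ^+ 2.
  under [RHS]eq_Rintegral => t _.
    have -> : (s * f t - g t) ^+ 2 = (s ^+ 2 * f t ^+ 2 - (2 * s) *
      (f t * g t)) + g t ^+ 2 by ring.
    over.
  rewrite RintegralD//; last exact: rintbleB measurableT (rintbleZ _ measurableT f2)
    (rintbleZ _ measurableT fg).
  rewrite RintegralB//; [|exact: rintbleZ..].
  by rewrite !RintegralZl//; ring.
by apply: Rintegral_ge0 => t _; rewrite sqr_ge0.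
Qed.

(** Meant for translations and reflections, which move any centre on the line to the origin.
    Continuity yields measurability, and it pulls neighbourhoods back when closed supports are
    translated. *)
Definition mu_preserving (phi : R -> R) := [/\ continuous phi &
  forall A : set R, measurable A -> mu (phi @^-1` A) = mu A].

Lemma mu_preserving_meas phi : mu_preserving phi -> measurable_fun setT phi.
Proof. by move=> [c _]; exact: continuous_measurable_fun. Qed.

Lemma mu_preserving_shift a : mu_preserving (fun t => t + a).
Proof.
split; first by move=> t; apply: cvgD; [exact: cvg_id|exact: cvg_cst].
have m : measurable_fun setT (fun t : R => t + a).
  by apply: continuous_measurable_fun => t; apply: cvgD; [exact: cvg_id|exact: cvg_cst].
pose phi : measurableTypeR R -> measurableTypeR R := fun t => t + a.
move=> A mA; have mphi : measurable_fun setT phi by [].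
apply/esym.
(* Lebesgue measure is determined by the lengths of half-open intervals, so the pushforward is
   compared on these alone. *)
apply: (@lebesgue_measure_unique R (pushforward mu phi)) => //.
move=> _ [[x y] _ <-] /=.
rewrite /pushforward.
have -> : phi @^-1` `]x, y]%classic = `]x - a, y - a]%classic.
  by apply/seteqP; split => t /=; rewrite /phi !in_itv/= ltrBlDr lerBrDr.
rewrite !lebesgue_measure_itv/= !lte_fin ltrD2r.
by case: ifP => // _; congr (_%:E); ring.
Qed.

Lemma mu_preserving_opp : mu_preserving (fun t => - t).
Proof.
split; first by move=> t; apply: cvgN; exact: cvg_id.
move=> A mA; exact: lebesgue_measureN.
Qed.

Lemma mu_preserving_comp phi psi : mu_preserving phi -> mu_preserving psi ->
  mu_preserving (phi \o psi).
Proof.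
move=> /[dup] /mu_preserving_meas mphi [c1 h1] [c2 h2]; split.
  by move=> t; apply: continuous_comp; [exact: c2|exact: c1].
move=> A mA; rewrite comp_preimage h2; first exact: h1.
by rewrite -[X in measurable X]setTI; exact: mphi.
Qed.

Lemma mu_preserving_measurable phi f : mu_preserving phi ->
  measurable_fun setT f -> measurable_fun setT (f \o phi).
Proof. by move=> /mu_preserving_meas mp mf; exact: measurableT_comp. Qed.

Lemma ge0_integral_mu_preserving phi (f : R -> \bar R) : mu_preserving phi ->
  measurable_fun setT f -> (forall t, 0 <= f t)%E ->
  (\int[mu]_t f (phi t) = \int[mu]_t f t)%E.
Proof.
move=> /[dup] /mu_preserving_meas mphi [_ h] mf f0.
have e := @ge0_integral_pushforward _ _ (measurableTypeR R)
  (measurableTypeR R) R phi mphi mu setT f.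
rewrite preimage_setT in e.
rewrite -e//; apply: eq_measure_integral => A mA _.
exact: h.
Qed.

Lemma rintble_mu_preserving phi f : mu_preserving phi ->
  rintble setT f -> rintble setT (f \o phi).
Proof.
move=> hphi /integrableP[mf lf]; apply/integrableP; split.
  apply/measurable_EFinP; apply: mu_preserving_measurable => //; exact/measurable_EFinP.
apply: le_lt_trans lf; rewrite -(@ge0_integral_mu_preserving phi (fun t => `|(f t)%:E|%E))//.
by apply: measurableT_comp => //; exact/measurable_EFinP.
Qed.

Lemma Rintegral_mu_preserving phi f : mu_preserving phi ->
  rintble setT f -> \int[mu]_t f (phi t) = \int[mu]_t f t.
Proof.
move=> hphi fi; have fip := rintble_mu_preserving hphi fi.
have mphi := mu_preserving_meas hphi.
have mf : measurable_fun setT (EFin \o f) by exact: measurable_int fi.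
have e := @integral_pushforward _ _ (measurableTypeR R) (measurableTypeR R) R phi
  mphi mu setT (EFin \o f) mf.
rewrite preimage_setT in e.
congr fine; rewrite -[LHS]e//; apply: eq_measure_integral => A mA _.
by case: hphi => _ h; exact: h.
Qed.

Lemma Rintegral_mu_preserving_set phi D f : measurable D -> mu_preserving phi ->
  rintble D f -> rintble (phi @^-1` D) (f \o phi) /\
  \int[mu]_(t in phi @^-1` D) f (phi t) = \int[mu]_(t in D) f t.
Proof.
move=> mD hphi fi.
have mD' : measurable (phi @^-1` D).
  by rewrite -[X in measurable X]setTI; apply: mu_preserving_meas.
have fi' : rintble setT (f \_ D).
  by have := (@integrable_mkcond _ _ R mu D (EFin \o f) mD).1 fi; rewrite restrict_EFin.
have e : ((f \o phi) \_ (phi @^-1` D)) = (f \_ D) \o phi.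
  by apply/funext => t; rewrite /patch/=.
split.
  apply/(@integrable_mkcond _ _ R mu _ (EFin \o (f \o phi)) mD'); rewrite restrict_EFin e.
  exact: rintble_mu_preserving.
rewrite Rintegral_mkcond [RHS]Rintegral_mkcond -[RHS](Rintegral_mu_preserving hphi)//.
Qed.

Lemma negligible_mu_preserving phi (A : set R) : mu_preserving phi ->
  mu.-negligible A -> mu.-negligible (phi @^-1` A).
Proof.
move=> /[dup] /mu_preserving_meas mphi [_ h] [B [mB B0 AB]].
exists (phi @^-1` B); split.
- by rewrite -[X in measurable X]setTI; exact: mphi.
- by have := h _ mB; rewrite -[X in X = _ -> _]/(mu _) => ->.
- by move=> t /= /AB.
Qed.

End RealIntegration.

(** * Complex-valued integrals and the spaces L^1 and L^2 *)

Section ComplexIntegration.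
Variable R : realType.
Notation mu := (@lebesgue_measure R).
Implicit Types (f g : R -> R[i]) (D : set R) (a z w : R[i]).
Local Notation "z ^*" := (Num.conj z).
Local Notation Re := (@complex.Re R).
Local Notation Im := (@complex.Im R).

Lemma complex_eqP z w : Re z = Re w -> Im z = Im w -> z = w.
Proof. by case: z w => [? ?] [? ?] /= -> ->. Qed.

Lemma ReD z w : Re (z + w) = Re z + Re w. Proof. by case: z w => [? ?] [? ?]. Qed.
Lemma ImD z w : Im (z + w) = Im z + Im w. Proof. by case: z w => [? ?] [? ?]. Qed.
Lemma ReN z : Re (- z) = - Re z. Proof. by case: z. Qed.
Lemma ImN z : Im (- z) = - Im z. Proof. by case: z. Qed.
Lemma ReM z w : Re (z * w) = Re z * Re w - Im z * Im w.
Proof. by case: z w => [? ?] [? ?]. Qed.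
Lemma ImM z w : Im (z * w) = Re z * Im w + Im z * Re w.
Proof. by case: z w => [? ?] [? ?]. Qed.
Lemma ReJ z : Re z^* = Re z. Proof. by case: z. Qed.
Lemma ImJ z : Im z^* = - Im z. Proof. by case: z. Qed.
Definition ReImE := (ReD, ImD, ReN, ImN, ReM, ImM, ReJ, ImJ).

Lemma normc_sqr z : normc z ^+ 2 = Re z ^+ 2 + Im z ^+ 2.
Proof. by case: z => x y /=; rewrite sqr_sqrtr// addr_ge0// sqr_ge0. Qed.

Lemma normc_ge0 z : 0 <= normc z. Proof. by case: z => x y /=; exact: sqrtr_ge0. Qed.

Lemma normc_sqrt z : normc z = Num.sqrt (Re z ^+ 2 + Im z ^+ 2).
Proof. by case: z. Qed.

Lemma normc_eq0 z : (normc z == 0) = (z == 0).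
Proof. by apply/eqP/eqP => [/eq0_normc//|->]; rewrite normc0. Qed.

Lemma normcJ z : normc z^* = normc z.
Proof. by rewrite !normc_sqrt ReJ ImJ sqrrN. Qed.

Lemma normcR (r : R) : normc r%:C = `|r|.
Proof. by rewrite normc_sqrt /= expr0n addr0 sqrtr_sqr. Qed.

Lemma mulJc z : z * z^* = (normc z ^+ 2)%:C.
Proof. by rewrite normc_sqr; case: z => x y; apply: complex_eqP => /=; ring. Qed.

Lemma normr_Re_le z : `|Re z| <= normc z.
Proof. by rewrite normc_sqrt -sqrtr_sqr ler_wsqrtr// lerDl sqr_ge0. Qed.

Lemma normr_Im_le z : `|Im z| <= normc z.
Proof. by rewrite normc_sqrt -sqrtr_sqr ler_wsqrtr// lerDr sqr_ge0. Qed.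

Lemma normc_le_ReIm z : normc z <= `|Re z| + `|Im z|.
Proof.
rewrite -[leRHS]ger0_norm ?addr_ge0// -sqrtr_sqr normc_sqrt ler_wsqrtr//.
rewrite -(real_normK (num_real (Re z))) -(real_normK (num_real (Im z))).
by have := normr_ge0 (Re z); have := normr_ge0 (Im z); nra.
Qed.

Lemma le_normcB z w : normc (z - w) <= normc z + normc w.
Proof. by rewrite -(normcN w); exact: le_normcD. Qed.

Definition cmeas f :=
  measurable_fun setT (Re \o f) /\ measurable_fun setT (Im \o f).

Lemma cmeas_cst a : cmeas (cst a). Proof. by split; exact: measurable_cst. Qed.

Lemma cmeasD f g : cmeas f -> cmeas g -> cmeas (fun t => f t + g t).
Proof.
move=> [f1 f2] [g1 g2]; split.
  by rewrite (_ : _ \o _ = (fun t => Re (f t) + Re (g t)));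
    [exact: measurable_funD|apply/funext => t /=; rewrite ReD].
by rewrite (_ : _ \o _ = (fun t => Im (f t) + Im (g t)));
  [exact: measurable_funD|apply/funext => t /=; rewrite ImD].
Qed.

Lemma cmeasM f g : cmeas f -> cmeas g -> cmeas (fun t => f t * g t).
Proof.
move=> [f1 f2] [g1 g2]; split.
  rewrite (_ : _ \o _ = (fun t => Re (f t) * Re (g t) - Im (f t) * Im (g t))).
    by apply: measurable_funB; exact: measurable_funM.
  by apply/funext => t /=; rewrite ReM.
rewrite (_ : _ \o _ = (fun t => Re (f t) * Im (g t) + Im (f t) * Re (g t))).
  by apply: measurable_funD; exact: measurable_funM.
by apply/funext => t /=; rewrite ImM.
Qed.

Lemma cmeasJ f : cmeas f -> cmeas (fun t => (f t)^*).
Proof.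
move=> [f1 f2]; split.
  by rewrite (_ : _ \o _ = Re \o f)//; apply/funext => t /=; rewrite ReJ.
rewrite (_ : _ \o _ = \- (Im \o f)); first exact: measurable_funN.
by apply/funext => t /=; rewrite ImJ.
Qed.

Lemma cmeas_comp f phi : measurable_fun setT (phi : R -> R) -> cmeas f -> cmeas (f \o phi).
Proof. by move=> mp [f1 f2]; split; rewrite compA; exact: measurableT_comp. Qed.

Lemma cmeas_normc f : cmeas f -> measurable_fun setT (fun t => normc (f t)).
Proof.
move=> [f1 f2]; rewrite (_ : (fun _ => _) = fun t => Num.sqrt (Re (f t) ^+ 2 + Im (f t) ^+ 2)).
  apply: (measurableT_comp (f := @Num.sqrt R)).
    by apply: continuous_measurable_fun; exact: sqrt_continuous.
  by apply: measurable_funD; exact: measurable_funX.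
by apply/funext => t; rewrite normc_sqrt.
Qed.

Definition cintble D f := rintble D (Re \o f) /\ rintble D (Im \o f).

Lemma cintble_dom D f (g : R -> R) : measurable D -> cmeas f -> rintble D g ->
  (forall t, D t -> normc (f t) <= g t) -> cintble D f.
Proof.
move=> mD [f1 f2] ig h; split; apply: rintble_dom ig _ => // t Dt;
  by rewrite (le_trans _ (h _ Dt))// ?normr_Re_le ?normr_Im_le.
Qed.

Lemma cintble_lin D f g a : measurable D -> cintble D f -> cintble D g ->
  cintble D (fun t => a * f t + g t).
Proof.
move=> mD [f1 f2] [g1 g2]; split.
- rewrite (_ : _ \o _ = (fun t => (Re a * Re (f t) - Im a * Im (f t)) + Re (g t))).
    by apply: rintbleD => //; apply: rintbleB => //; exact: rintbleZ.
  by apply/funext => t /=; rewrite !ReImE.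
- rewrite (_ : _ \o _ = (fun t => (Re a * Im (f t) + Im a * Re (f t)) + Im (g t))).
    by apply: rintbleD => //; apply: rintbleD => //; exact: rintbleZ.
  by apply/funext => t /=; rewrite !ReImE.
Qed.

Lemma cintegral_lin D f g a : measurable D -> cintble D f -> cintble D g ->
  cintegral D (fun t => a * f t + g t) = a * cintegral D f + cintegral D g.
Proof.
move=> mD [f1 f2] [g1 g2]; apply: complex_eqP; rewrite !ReImE /=.
- under eq_Rintegral do rewrite !ReImE.
  rewrite RintegralD//; last by apply: rintbleB => //; exact: rintbleZ.
  by rewrite RintegralB//; [|exact: rintbleZ..]; rewrite !RintegralZl.
- under eq_Rintegral do rewrite !ReImE.
  rewrite RintegralD//; last by apply: rintbleD => //; exact: rintbleZ.
  by rewrite RintegralD//; [|exact: rintbleZ..]; rewrite !RintegralZl.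
Qed.

Lemma eq_cintegral D f g : {in D, f =1 g} -> cintegral D f = cintegral D g.
Proof.
by move=> fg; apply: complex_eqP => /=; apply: eq_Rintegral => t Dt; rewrite fg.
Qed.

Lemma cintble0 D : measurable D -> cintble D (cst 0).
Proof. by move=> mD; split; exact: (@integrable0 _ _ _ mu D). Qed.

Lemma cintegral0 D : cintegral D (cst 0 : R -> R[i]) = 0.
Proof.
by apply: complex_eqP; rewrite /= /Rintegral integral0_eq.
Qed.

Lemma cintbleD D f g : measurable D -> cintble D f -> cintble D g ->
  cintble D (fun t => f t + g t).
Proof.
move=> mD fi gi; have := cintble_lin 1 mD fi gi.
by congr cintble; apply/funext => t; rewrite mul1r.
Qed.

Lemma cintegralD D f g : measurable D -> cintble D f -> cintble D g ->
  cintegral D (fun t => f t + g t) = cintegral D f + cintegral D g.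
Proof.
move=> mD fi gi; rewrite -[X in X + _]mul1r -cintegral_lin//.
by apply: eq_cintegral => t _; rewrite mul1r.
Qed.

Lemma cintbleZ D f a : measurable D -> cintble D f -> cintble D (fun t => a * f t).
Proof.
move=> mD fi; have := cintble_lin a mD fi (cintble0 mD).
by congr cintble; apply/funext => t; rewrite addr0.
Qed.

Lemma cintegralZ D f a : measurable D -> cintble D f ->
  cintegral D (fun t => a * f t) = a * cintegral D f.
Proof.
move=> mD fi; rewrite -[RHS]addr0 -(cintegral0 D) -cintegral_lin//; last exact: cintble0.
by apply: eq_cintegral => t _; rewrite addr0.
Qed.

Lemma cintegralB D f g : measurable D -> cintble D f -> cintble D g ->
  cintegral D (fun t => f t - g t) = cintegral D f - cintegral D g.
Proof.
move=> mD fi gi; rewrite -[X in _ - X]mul1r -mulNr addrC -cintegral_lin//.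
by apply: eq_cintegral => t _; rewrite mulN1r addrC.
Qed.

Lemma cintble_sum D (I : Type) (s : seq I) (F : I -> R -> R[i]) : measurable D ->
  (forall i, cintble D (F i)) -> cintble D (fun t => \sum_(i <- s) F i t).
Proof.
move=> mD h; elim: s => [|i s ih].
  by under eq_fun do rewrite big_nil; exact: cintble0.
by under eq_fun do rewrite big_cons; exact: cintbleD.
Qed.

Lemma cintegral_sum D (I : Type) (s : seq I) (F : I -> R -> R[i]) : measurable D ->
  (forall i, cintble D (F i)) ->
  cintegral D (fun t => \sum_(i <- s) F i t) = \sum_(i <- s) cintegral D (F i).
Proof.
move=> mD h; elim: s => [|i s ih].
  by under eq_cintegral do rewrite big_nil; rewrite cintegral0 big_nil.
under eq_cintegral do rewrite big_cons.
by rewrite cintegralD// ?ih ?big_cons//; exact: cintble_sum.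
Qed.

Lemma cintegralJ D f : measurable D -> cintble D f ->
  cintegral D (fun t => (f t)^*) = (cintegral D f)^*.
Proof.
move=> mD [f1 f2]; apply: complex_eqP; rewrite !ReImE /=.
  by apply: eq_Rintegral => t _; rewrite ReJ.
under eq_Rintegral => t _ do rewrite ImJ -mulN1r.
by rewrite RintegralZl// mulN1r.
Qed.

Lemma rintble_normc D f : measurable D -> cmeas f -> cintble D f ->
  rintble D (fun t => normc (f t)).
Proof.
move=> mD mf [f1 f2]; apply: (@rintble_dom _ _ _ (fun t => `|Re (f t)| + `|Im (f t)|)) => //.
- exact: cmeas_normc.
- by apply: rintbleD => //; exact: integrable_norm.
- by move=> t _; rewrite ger0_norm ?normc_ge0// normc_le_ReIm.
Qed.

(** Multiplication by the conjugate of the integral [I] rotates it onto the positive real axis: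
    |I|^2 is the integral of Re(conj(I) f), which is at most |I| times the integral of |f|. *)
Lemma le_normc_cintegral D f : measurable D -> cmeas f -> cintble D f ->
  normc (cintegral D f) <= \int[mu]_(t in D) normc (f t).
Proof.
move=> mD mf fi; have fn := rintble_normc mD mf fi.
set I := cintegral D f; have [I0|I0] := eqVneq (normc I) 0.
  by rewrite I0; apply: Rintegral_ge0 => t _; exact: normc_ge0.
have I0' : 0 < normc I by rewrite lt_neqAle eq_sym I0 normc_ge0.
have e : normc I ^+ 2 = \int[mu]_(t in D) Re (I^* * f t).
  rewrite -[LHS]/(Re (normc I ^+ 2)%:C) -mulJc mulrC.
  by rewrite -cintegralZ.
rewrite -(ler_pM2l I0') -expr2 e -RintegralZl//.
have [r1 _] := cintbleZ I^* mD fi.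
apply: le_Rintegral => //; first exact: rintbleZ.
move=> t _; rewrite -(normcJ I) -normcM.
by rewrite (le_trans (ler_norm _))// normr_Re_le.
Qed.

Lemma cintegral_ae_eq f g : cmeas f -> cmeas g -> f = g %[ae mu] ->
  cintegral setT f = cintegral setT g.
Proof.
move=> [f1 f2] [g1 g2] fg; apply: complex_eqP => /=; apply: Rintegral_ae_eq => //;
  by apply: (ae_eq_mono fg) => t ->.
Qed.

Lemma cintegral_mu_preserving phi D f : measurable D -> mu_preserving phi ->
  cintble D f -> cintegral (phi @^-1` D) (f \o phi) = cintegral D f.
Proof.
move=> mD hp [f1 f2]; apply: complex_eqP => /=.
- exact: (Rintegral_mu_preserving_set mD hp f1).2.
- exact: (Rintegral_mu_preserving_set mD hp f2).2.
Qed.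

(** Membership is defined componentwise; this passes to the modulus, on which the later estimates
    are made. *)
Lemma isLp1P f : isLp 1%:E f <-> cmeas f /\ rintble setT (fun t => normc (f t)).
Proof.
split=> [[f1 f2]|[[f1 f2] fi]].
  have h1 := (Lfun1_integrable _ _).1 f1; have h2 := (Lfun1_integrable _ _).1 f2.
  have mf : cmeas f.
    by split; apply/measurable_EFinP; [exact: measurable_int h1|exact: measurable_int h2].
  by split => //; apply: rintble_normc.
have [? ?] : cintble setT f by apply: cintble_dom fi _.
by split; exact/Lfun1_integrable.
Qed.

Lemma Lfun2_sqr (h : R -> R) : measurable_fun setT h -> rintble setT (fun t => h t ^+ 2) ->
  h \in Lfun mu 2%:E.
Proof.
move=> mh hi; rewrite inE; apply/andP; split; rewrite inE//=.
rewrite /finite_norm unlock /Lnorm poweR_lty//.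
have -> : (fun x => (`|(EFin \o h) x| `^ 2)%E) = (fun x => (h x ^+ 2)%:E).
  by apply/funext => t /=; rewrite powR_mulrn// real_normK ?num_real.
have := (integrable_fin_num measurableT hi).
by rewrite ge0_fin_numE// integral_ge0// => t _; rewrite lee_fin sqr_ge0.
Qed.

Lemma isLp2P f : isLp 2%:E f <-> cmeas f /\ rintble setT (fun t => normc (f t) ^+ 2).
Proof.
split=> [[f1 f2]|[[f1 f2] fi]].
  have h1 := Lfun2_integrable_sqr f1; have h2 := Lfun2_integrable_sqr f2.
  split.
    by split; [move: f1|move: f2]; rewrite inE => /andP[]; rewrite inE.
  under eq_fun do rewrite normc_sqr.
  exact: rintbleD.
split; apply: Lfun2_sqr => //; apply: rintble_dom fi _ => //; try exact: measurable_funX.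
  by move=> t _; rewrite normc_sqr ger0_norm ?sqr_ge0// lerDl sqr_ge0.
by move=> t _; rewrite normc_sqr ger0_norm ?sqr_ge0// lerDr sqr_ge0.
Qed.

Lemma isLp2_ReIm f : isLp 2%:E f ->
  rintble setT (fun t => Re (f t) ^+ 2) /\ rintble setT (fun t => Im (f t) ^+ 2).
Proof. by move=> [f1 f2]; split; [exact: Lfun2_integrable_sqr f1|exact:
  Lfun2_integrable_sqr f2]. Qed.

Lemma isLp2_cmeas f : isLp 2%:E f -> cmeas f. Proof. by move=> /isLp2P[]. Qed.

Lemma isLp2_lin f g a : isLp 2%:E f -> isLp 2%:E g -> isLp 2%:E (fun t => a * f t + g t).
Proof.
move=> /isLp2P[mf fi] /isLp2P[mg gi]; apply/isLp2P.
have m : cmeas (fun t => a * f t + g t).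
  by apply: cmeasD => //; apply: cmeasM => //; exact: cmeas_cst.
split => //.
apply: (@rintble_dom _ _ _ (fun t => (2 * normc a ^+ 2) * normc (f t) ^+ 2 + 2 * normc
  (g t) ^+ 2)) => //.
- by apply: measurable_funX; exact: cmeas_normc.
- by apply: rintbleD => //; exact: rintbleZ.
- move=> t _; rewrite ger0_norm ?sqr_ge0//.
  have := le_normcD (a * f t) (g t); rewrite normcM.
  have := normc_ge0 (a * f t + g t); have := normc_ge0 a; have := normc_ge0 (f t).
  have := normc_ge0 (g t); move: (normc _) (normc a) (normc (f t)) (normc (g t)) => A x y z.
  move=> z0 y0 x0 A0 h.
  have h2 : A ^+ 2 <= (x * y + z) ^+ 2 by rewrite ler_pXn2r ?nnegrE ?addr_ge0 ?mulr_ge0.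
  by have := sqr_ge0 (x * y - z); nra.
Qed.

Lemma isLp2_0 : isLp 2%:E (cst 0 : R -> R[i]).
Proof.
apply/isLp2P; split; first exact: cmeas_cst.
rewrite (_ : (fun _ => _) = cst 0); first exact: (@integrable0 _ _ _ mu setT).
by apply/funext => t; rewrite normc0 expr0n.
Qed.

Lemma isLp2Z f a : isLp 2%:E f -> isLp 2%:E (fun t => a * f t).
Proof.
move=> h; have := isLp2_lin a h isLp2_0.
by congr isLp; apply/funext => t; rewrite addr0.
Qed.

Lemma isLp2D f g : isLp 2%:E f -> isLp 2%:E g -> isLp 2%:E (fun t => f t + g t).
Proof.
move=> h h'; have := isLp2_lin 1 h h'.
by congr isLp; apply/funext => t; rewrite mul1r.
Qed.

Lemma isLp2_sum (I : Type) (s : seq I) (F : I -> R -> R[i]) :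
  (forall i, isLp 2%:E (F i)) -> isLp 2%:E (fun t => \sum_(i <- s) F i t).
Proof.
move=> h; elim: s => [|i s ih].
  by under eq_fun do rewrite big_nil; exact: isLp2_0.
by under eq_fun do rewrite big_cons; exact: isLp2D.
Qed.

Lemma isLp2J f : isLp 2%:E f -> isLp 2%:E (fun t => (f t)^*).
Proof.
move=> /isLp2P[mf fi]; apply/isLp2P; split; first exact: cmeasJ.
by under eq_fun do rewrite normcJ.
Qed.

Lemma rintble_normcM f g : isLp 2%:E f -> isLp 2%:E g ->
  rintble setT (fun t => normc (f t) * normc (g t)).
Proof.
by move=> /isLp2P[mf fi] /isLp2P[mg gi]; apply: rintble_mul => //; exact: cmeas_normc.
Qed.

Lemma cintbleM f g : isLp 2%:E f -> isLp 2%:E g -> cintble setT (fun t => f t * g t).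
Proof.
move=> hf hg; have [mf _] := (isLp2P f).1 hf; have [mg _] := (isLp2P g).1 hg.
apply: cintble_dom (rintble_normcM hf hg) _ => //; first exact: cmeasM.
by move=> t _; rewrite normcM.
Qed.

Lemma cintbleMJ f g : isLp 2%:E f -> isLp 2%:E g -> cintble setT (fun t => f t * (g t)^*).
Proof. by move=> hf hg; apply: cintbleM => //; exact: isLp2J. Qed.

Lemma L2norm_ge0 f : 0 <= L2norm f. Proof. exact: sqrtr_ge0. Qed.

Lemma L2norm_sqr f : L2norm f ^+ 2 = \int[mu]_t normc (f t) ^+ 2.
Proof. by rewrite sqr_sqrtr// Rintegral_ge0// => t _; rewrite sqr_ge0. Qed.

Lemma cauchy_schwarz f g : isLp 2%:E f -> isLp 2%:E g ->
  \int[mu]_t (normc (f t) * normc (g t)) <= L2norm f * L2norm g.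
Proof.
by move=> /isLp2P[mf fi] /isLp2P[mg gi]; apply: Rcauchy_schwarz => //; exact: cmeas_normc.
Qed.

Lemma le_cintegralM f g : isLp 2%:E f -> isLp 2%:E g ->
  normc (cintegral setT (fun t => f t * g t)) <= L2norm f * L2norm g.
Proof.
move=> hf hg; apply: le_trans (cauchy_schwarz hf hg).
apply: (le_trans (le_normc_cintegral measurableT _ (cintbleM hf hg))).
  by apply: cmeasM; exact: isLp2_cmeas.
by under eq_Rintegral do rewrite normcM.
Qed.

End ComplexIntegration.

(** * Decaying exponentials and integration by parts *)

Section HalfLine.
Variable R : realType.
Notation mu := (@lebesgue_measure R).

Lemma expR_decay_cvg0 (k : R) : 0 < k -> expR (- (k * t)) @[t --> +oo] --> (0 : R).
Proof.
move=> k0; rewrite (_ : (fun t => _) = (fun t : R => expR (- t)) \o (fun t => k * t))//.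
apply: (@cvg_comp _ _ _ _ _ _ (pinfty_nbhs R)); last exact: cvgr_expR.
exact: gt0_cvgMry.
Qed.

Lemma is_derive_scale (c d t : R) (F : R -> R) : is_derive t 1 F d ->
  is_derive t 1 (fun s => c * F s) (c * d).
Proof. exact: (@is_deriveZ R R^o R^o F c t 1 d). Qed.

Lemma is_derive_add (d e t : R) (F G : R -> R) : is_derive t 1 F d ->
  is_derive t 1 G e -> is_derive t 1 (fun s => F s + G s) (d + e).
Proof. exact: (@is_deriveD R R^o R^o F G t 1 d e). Qed.

Lemma is_derive_mul (d e t : R) (F G : R -> R) : is_derive t 1 F d ->
  is_derive t 1 G e -> is_derive t 1 (fun s => F s * G s) (F t * e + G t * d).
Proof. exact: (@is_deriveM R R^o F G t 1 d e). Qed.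

Lemma is_derive_mulc (c t : R) : is_derive t 1 (fun t => c * t) c.
Proof. by have := is_derive_scale c (@is_derive_id _ R^o t 1); rewrite mulr1. Qed.

Lemma is_derive_expR_lin (c t : R) : is_derive t 1 (fun t => expR (c * t)) (c * expR (c * t)).
Proof.
have h := is_derive_mulc c t.
by have := @is_derive1_comp _ expR (fun t => c * t) t _ _ (is_derive_expR (c * t)) h;
  rewrite mulrC.
Qed.

Lemma is_derive_cos_lin (c t : R) : is_derive t 1 (fun t => cos (c * t)) (- c * sin (c * t)).
Proof.
have h := is_derive_mulc c t.
by have := @is_derive1_comp _ cos (fun t => c * t) t _ _ (is_derive_cos (c * t)) h;
  rewrite mulrC mulNr mulrN.
Qed.

Lemma is_derive_sin_lin (c t : R) : is_derive t 1 (fun t => sin (c * t)) (c * cos (c * t)).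
Proof.
have h := is_derive_mulc c t.
by have := @is_derive1_comp _ sin (fun t => c * t) t _ _ (is_derive_sin (c * t)) h;
  rewrite mulrC.
Qed.

Lemma is_derive_continuous (f df : R -> R) :
  (forall t : R, is_derive t 1 f (df t)) -> continuous f.
Proof.
move=> h t; apply: differentiable_continuous; apply/derivable1_diffP.
by case: (h t).
Qed.

Lemma is_derive_expR_decay (k t : R) :
  is_derive t 1 (fun t => expR (- (k * t))) (- k * expR (- (k * t))).
Proof.
have := is_derive_expR_lin (- k) t.
by rewrite (_ : (fun _ => _) = (fun t => expR (- (k * t)))) ?mulNr//; apply/funext => s;
  rewrite mulNr.
Qed.

Lemma is_derive_expR_primitive (k t : R) : 0 < k ->
  is_derive t 1 (fun t => - k^-1 * expR (- (k * t))) (expR (- (k * t))).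
Proof.
move=> k0; have h := is_derive_scale (- k^-1) (is_derive_expR_decay k t).
apply: (is_derive_eq h).
by field; rewrite gt_eqF.
Qed.

Lemma continuous_expR_decay (k : R) : continuous (fun t : R => expR (- (k * t))).
Proof. exact: is_derive_continuous (is_derive_expR_decay k). Qed.

Lemma continuous_within (D : set R) (f : R -> R) : continuous f -> {within D, continuous f}.
Proof. by move=> cf; apply: continuous_subspaceT. Qed.

(** Nonnegativity makes integrability a consequence of the formula, since the integral of [f] is
    then that of its modulus and has a finite value. *)
Lemma ge0_ftc_infty (f F : R -> R) (a : R) : (forall t, 0 <= f t) -> continuous f ->
  (forall t : R, is_derive t 1 F (f t)) -> F t @[t --> +oo] --> (0 : R) ->
  rintble `[a, +oo[ f /\ \int[mu]_(t in `[a, +oo[) f t = - F a.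
Proof.
move=> f0 cf dF F0.
have e : (\int[mu]_(x in `[a, +oo[) (f x)%:E = 0%:E - (F a)%:E)%E.
  apply: ge0_continuous_FTC2y => //.
  - exact: continuous_within.
  - by apply: cvg_at_right_filter; exact: (is_derive_continuous dF).
  - by move=> t _; rewrite derive1E; case: (dF t).
split; last by rewrite /Rintegral e sub0e.
apply/integrableP; split.
  by apply/measurable_EFinP; apply: measurable_funTS; exact: continuous_measurable_fun.
under eq_integral do rewrite gee0_abs ?lee_fin//.
by rewrite e ltry.
Qed.

Lemma rintble_expR_decay (k a : R) : 0 < k ->
  rintble `[a, +oo[ (fun t => expR (- (k * t))) /\
  \int[mu]_(t in `[a, +oo[) expR (- (k * t)) = expR (- (k * a)) / k.
Proof.
move=> k0; pose F (t : R) := - k^-1 * expR (- (k * t)).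
have dF (t : R) : is_derive t 1 F (expR (- (k * t))).
  exact: is_derive_expR_primitive.
have c := @continuous_expR_decay k.
have F0 : F t @[t --> +oo] --> (0 : R).
  by rewrite -(mulr0 (- k^-1)); apply: cvgM; [exact: cvg_cst|exact: expR_decay_cvg0].
have [h1 h2] := ge0_ftc_infty a (fun t => expR_ge0 _) c dF F0.
by split => //; rewrite h2 /F mulNr opprK mulrC.
Qed.

(* [f] may change sign: the nonnegative version applies to [f + K exp(-k t)]. *)
Lemma decay_ftc_infty (f F : R -> R) (k K : R) : 0 < k -> continuous f ->
  (forall t : R, is_derive t 1 F (f t)) ->
  (forall t, `|f t| <= K * expR (- (k * t))) ->
  (forall t, `|F t| <= expR (- (k * t))) ->
  forall a, rintble `[a, +oo[ f /\ \int[mu]_(t in `[a, +oo[) f t = - F a.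
Proof.
move=> k0 cf dF hf hF a.
have [e1 e2] := rintble_expR_decay a k0.
pose E (t : R) := - k^-1 * expR (- (k * t)).
have dE (t : R) : is_derive t 1 E (expR (- (k * t))).
  exact: is_derive_expR_primitive.
have c := @continuous_expR_decay k.
pose f1 t := f t + K * expR (- (k * t)); pose F1 t := F t + K * E t.
have f10 t : 0 <= f1 t by have := hf t; rewrite ler_norml => /andP[]; rewrite /f1; lra.
have cf1 : continuous f1.
  by move=> t; apply: cvgD; [exact: cf|apply: cvgM; [exact: cvg_cst|exact: c]].
have dF1 (t : R) : is_derive t 1 F1 (f1 t).
  exact: is_derive_add (dF t) (is_derive_scale K (dE t)).
have F0 : F t @[t --> +oo] --> (0 : R).
  apply/norm_cvg0P.
  apply: (@squeeze_cvgr _ _ _ _ (cst 0) (fun t => expR (- (k * t)))).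
  - by near=> t; rewrite normr_ge0 hF.
  - exact: cvg_cst.
  - exact: expR_decay_cvg0.
have F10 : F1 t @[t --> +oo] --> (0 : R).
  rewrite -[X in _ --> X]addr0; apply: cvgD => //.
  rewrite -(mulr0 K); apply: cvgM; first exact: cvg_cst.
  by rewrite -(mulr0 (- k^-1)); apply: cvgM; [exact: cvg_cst|exact: expR_decay_cvg0].
have [i1 i2] := ge0_ftc_infty a f10 cf1 dF1 F10.
have fE : f = fun t => f1 t - K * expR (- (k * t)) by apply/funext => t; rewrite /f1 addrK.
split; first by rewrite fE; apply: rintbleB => //; exact: rintbleZ.
transitivity (\int[mu]_(t in `[a, +oo[) (f1 t - K * expR (- (k * t)))).
  by apply: eq_Rintegral => t _; rewrite /f1 addrK.
rewrite RintegralB//; last exact: rintbleZ.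
rewrite RintegralZl// i2 e2 /F1 /E.
by field; rewrite gt_eqF.
Unshelve. all: by end_near. Qed.

End HalfLine.

(** * Integration by parts on a half-line through Fubini *)

Section IntegrationByParts.
Variable R : realType.
Notation mu := (@lebesgue_measure R).

(** On a bounded interval L^2 sits inside L^1, because |a| <= a^2 + 1. *)
Lemma rintble_sqr_itv (a : R -> R) (x y : R) : measurable_fun setT a ->
  rintble setT (fun t => a t ^+ 2) -> rintble `[x, y] a.
Proof.
move=> ma ia; apply: (@rintble_dom _ _ _ (fun t => a t ^+ 2 + 1)) => //.
  apply: rintbleD => //; first exact: rintbleS ia.
  apply: (@measurable_bounded_integrable _ _ R mu (cst 1)) => //.
    by rewrite /= lebesgue_measure_itv; case: ifP => //= _; rewrite -EFinB ltry.
  by exists 1; split => // M M1 t _ /=; rewrite normr1 ltW.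
by move=> t _; rewrite -(real_normK (num_real (a t))); have := normr_ge0 (a t); nra.
Qed.

Lemma EFin_Rintegral (D : set R) (h : R -> R) : measurable D -> rintble D h ->
  (\int[mu]_(t in D) (h t)%:E)%E = (\int[mu]_(t in D) h t)%:E.
Proof. by move=> mD ih; rewrite /Rintegral fineK//; exact: integrable_fin_num. Qed.

Lemma measurable_triangle : measurable [set p : R * R | 0 <= p.1 <= p.2].
Proof.
have -> : [set p : R * R | 0 <= p.1 <= p.2] =
  (fst @^-1` `[0, +oo[%classic) `&` ((fun p => p.2 - p.1) @^-1` `[0, +oo[%classic).
  apply/seteqP; split => -[s y] /=; rewrite !in_itv/= !andbT subr_ge0.
    by move=> /andP[].
  by move=> [-> ->].
apply: measurableI.
  by rewrite -[X in measurable X]setTI; exact: measurable_fst.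
by rewrite -[X in measurable X]setTI; exact: measurable_funB.
Qed.

(** [A] is only an indefinite integral of [a], so the product rule is replaced by Fubini for a(s)
    f(y) on the triangle 0 <= s <= y. Integrating in y first gives -a(s) F(s); integrating in s
    first gives (A(y) - A(0)) f(y). *)
Lemma ibp_half (A a F f : R -> R) (k K : R) :
  measurable_fun setT a -> rintble setT (fun t => a t ^+ 2) ->
  (forall y, 0 <= y -> A y - A 0 = \int[mu]_(t in `[0, y]) a t) ->
  0 < k -> continuous f -> (forall t : R, is_derive t 1 F (f t)) ->
  (forall t, `|f t| <= K * expR (- (k * t))) ->
  (forall t, `|F t| <= expR (- (k * t))) ->
  rintble `[0, +oo[ (fun t => A t * f t) -> rintble `[0, +oo[ (fun t => a t * F t) ->
  rintble `[0, +oo[ (fun t => a t * expR (- (k * t))) ->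
  \int[mu]_(t in `[0, +oo[) (a t * F t + A t * f t) = - (A 0 * F 0).
Proof.
move=> ma ia hA k0 cf dF hf hF iAf iaF iae.
have mf : measurable_fun setT f by exact: continuous_measurable_fun.
have ftc := decay_ftc_infty k0 cf dF hf hF.
pose T := [set p : R * R | 0 <= p.1 <= p.2].
pose G := (fun p : R * R => a p.1 * f p.2) \_ T.
have mG : measurable_fun setT (EFin \o G).
  apply/measurable_EFinP; apply: (measurable_restrictT _ measurable_triangle).1.
  apply: measurable_funTS; apply: measurable_funM.
    exact: (measurableT_comp ma measurable_fst).
  exact: (measurableT_comp mf measurable_snd).
have GE s y : G (s, y) = if 0 <= s <= y then a s * f y else 0.
  by rewrite /G patchE; case: ifPn => [/set_mem/= -> //|/negP h]; case: ifPn => // h';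
    case: h; exact: mem_set.
have G1 s : G \o (pair s) = if 0 <= s then (fun y => a s * f y) \_ `[s, +oo[ else cst 0.
  apply/funext => y /=; rewrite GE; case: ifPn => [/andP[-> sy]|].
    by rewrite patchE mem_set//= in_itv/= sy.
  case: (0 <= s) => //= sy; rewrite patchE memNset//=.
  by rewrite in_itv/= andbT; exact/negP.
have G2 y : (fun s => G (s, y)) = if 0 <= y then (fun s => a s * f y) \_ `[0, y] else cst 0.
  apply/funext => s /=; rewrite GE; case: ifPn => [/andP[s0 sy]|].
    by rewrite (le_trans s0 sy) patchE mem_set//= in_itv/= s0 sy.
  case: (0 <= y) => //= sy; rewrite patchE memNset//=.
  by rewrite in_itv/=; exact/negP.
have K0 : 0 <= K by have := hf 0; rewrite mulr0 oppr0 expR0 mulr1; apply: le_trans.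
have maf s : measurable_fun setT (fun y => a s * f y) by exact: measurable_funM.
(* The absolute integral over y is dominated by a multiple of |a(s)| exp(-ks), integrable in s by
   the last hypothesis; this gives integrability on the product. *)
have inner s : 0 <= s -> (\int[mu]_y `|(G (s, y))%:E| <= (`|a s| * (K * (expR (-
  (k * s)) / k)))%:E)%E.
  move=> s0.
  have -> : (fun y => `|(G (s, y))%:E|%E) = EFin \o ((fun y => `|a s * f y|) \_ `[s, +oo[).
    apply/funext => y; have := congr1 (@^~ y) (G1 s); rewrite s0 /= => ->.
    by rewrite !patchE; case: ifP => //=; rewrite normr0.
  rewrite -restrict_EFin -integral_mkcond.
  have [e1 e2] := rintble_expR_decay s k0.
  have iw : rintble `[s, +oo[ (fun y => (`|a s| * K) * expR (- (k * y))) by exact: rintbleZ.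
  have iv : rintble `[s, +oo[ (fun y => `|a s * f y|).
    apply: rintble_dom iw _ => //; first exact: measurableT_comp.
    by move=> y _; rewrite normr_id normrM -mulrA ler_wpM2l.
  rewrite EFin_Rintegral// lee_fin.
  apply: le_trans (le_Rintegral _ iv iw _) _ => //.
    by move=> y _; rewrite normrM -mulrA ler_wpM2l.
  by rewrite RintegralZl// e2 -mulrA lexx.
have mGs : measurable_fun setT (fun s => \int[mu]_y `|(EFin \o G) (s, y)|)%E.
  apply: (@measurable_fun_fubini_tonelli_F _ _ _ _ R mu (abse \o (EFin \o G))).
    exact: measurableT_comp.
  by move=> p; exact: abse_ge0.
have iG : (mu \x mu)%E.-integrable setT (EFin \o G).
  apply: (@integrable12ltyP _ _ _ _ R mu mu (EFin \o G) mG).2.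
  pose B := (fun s => `|a s| * (K * (expR (- (k * s)) / k))) \_ `[0, +oo[.
  have iB : rintble `[0, +oo[ (fun s => `|a s| * (K * (expR (- (k * s)) / k))).
    have := rintbleZ (K / k) (measurable_itv _) (integrable_norm iae).
    congr rintble; apply/funext => s; rewrite /= normrM (ger0_norm (expR_ge0 _)); ring.
  have iB2 : rintble setT B by rewrite /rintble -restrict_EFin;
    exact: ((@integrable_mkcond _ _ R mu _ _ (measurable_itv _)).1 iB).
  apply: (@le_lt_trans _ _ (\int[mu]_s (B s)%:E)%E).
    apply: ge0_le_integral => //.
    - by move=> s _; exact: integral_ge0.
    - exact: measurable_int iB2.
    - move=> s _; rewrite /B patchE; case: ifPn => [/set_mem/=|/negP].
        by rewrite in_itv/= andbT; exact: inner.
      move=> h; have s0 : (0 <= s) = false.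
        by apply/negP => s0; apply: h; rewrite mem_set//= in_itv/= s0.
      rewrite integral0_eq// => y _ /=; have := congr1 (@^~ y) (G1 s); rewrite s0 /= => ->.
      by rewrite normr0.
  by rewrite EFin_Rintegral// ltry.
have := Fubini iG.
(* Slices at fixed s: the tail integral of [f] from s is -F(s). *)
have -> : (fun s => \int[mu]_y (EFin \o G) (s, y))%E = EFin \o ((fun s => -1 *
  (a s * F s)) \_ `[0, +oo[).
  apply/funext => s /=.
  have -> : (fun y => (G (s, y))%:E) = EFin \o (G \o pair s) by [].
  rewrite G1 patchE mem_setE in_itv/= andbT; case: ifP => s0; last by rewrite integral0_eq.
  rewrite -restrict_EFin -integral_mkcond EFin_Rintegral//; last by apply: rintbleZ => //;
    exact: (ftc s).1.
  by rewrite RintegralZl ?(ftc s).2 ?mulrN ?mulN1r//; exact: (ftc s).1.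
(* Slices at fixed y: the integral of [a] over [0, y] is A(y) - A(0). *)
have -> : (fun y => \int[mu]_s (EFin \o G) (s, y))%E = EFin \o
  ((fun y => A y * f y - A 0 * f y) \_ `[0, +oo[).
  apply/funext => y /=.
  have -> : (fun s => (G (s, y))%:E) = EFin \o (fun s => G (s, y)) by [].
  rewrite G2 patchE mem_setE in_itv/= andbT; case: ifP => y0; last by rewrite integral0_eq.
  have ia' := rintble_sqr_itv 0 y ma ia.
  rewrite -restrict_EFin -integral_mkcond.
  have e : (fun s => a s * f y) = (fun s => f y * a s) by apply/funext => s; rewrite mulrC.
  rewrite e EFin_Rintegral//; last exact: rintbleZ.
  by rewrite RintegralZl// -hA// mulrBr ![f y * _]mulrC.
have if0 := (ftc 0).1.
have iAf0 := rintbleZ (A 0) (measurable_itv _) if0.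
have iaFN := rintbleZ (-1) (measurable_itv _) iaF.
rewrite -!restrict_EFin -!integral_mkcond !EFin_Rintegral//; last exact: rintbleB.
move=> [].
rewrite RintegralZl// RintegralB// RintegralZl// (ftc 0).2 RintegralD//.
lra.
Qed.

End IntegrationByParts.

(** * The Green kernel *)

Section Kernel.
Variable R : realType.
Notation mu := (@lebesgue_measure R).
Implicit Types (f g u v : R -> R[i]) (D : set R) (a z w : R[i]).
Local Notation "z ^*" := (Num.conj z).
Local Notation Re := (@complex.Re R).
Local Notation Im := (@complex.Im R).

(* [cexp k t] is [exp(i k t)] and [ik k] is [i k]. *)
Definition cexp (k : R[i]) (t : R) : R[i] :=
  (expR (- (Im k * t)) * cos (Re k * t)) +i* (expR (- (Im k * t)) * sin (Re k * t)).

Definition ik (k : R[i]) : R[i] := (- Im k) +i* Re k.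

Lemma ik_sqr k : ik k * ik k = - (k * k).
Proof. by apply: complex_eqP; rewrite !ReImE /=; ring. Qed.

Lemma normc_ik k : normc (ik k) = normc k.
Proof. by rewrite !normc_sqrt /= sqrrN addrC. Qed.

Lemma normc_cexp k t : normc (cexp k t) = expR (- (Im k * t)).
Proof.
rewrite normc_sqrt /= !exprMn -mulrDr cos2Dsin2 mulr1 sqrtr_sqr.
by rewrite ger0_norm// expR_ge0.
Qed.

Lemma cexp0 k : cexp k 0 = 1.
Proof. by apply: complex_eqP; rewrite /= !mulr0 oppr0 expR0 ?cos0 ?sin0 ?mulr1 ?mulr0. Qed.

Lemma is_derive_Re_cexp k (t : R) :
  is_derive t 1 (fun t => Re (cexp k t)) (Re (ik k * cexp k t)).
Proof.
apply: (is_derive_eq (is_derive_mul (is_derive_expR_decay (Im k) t) (is_derive_cos_lin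
  (Re k) t))).
by rewrite !ReImE /=; ring.
Qed.

Lemma is_derive_Im_cexp k (t : R) :
  is_derive t 1 (fun t => Im (cexp k t)) (Im (ik k * cexp k t)).
Proof.
apply: (is_derive_eq (is_derive_mul (is_derive_expR_decay (Im k) t) (is_derive_sin_lin
  (Re k) t))).
by rewrite !ReImE /=; ring.
Qed.

Lemma continuous_cexp k :
  continuous (fun t => Re (cexp k t)) /\ continuous (fun t => Im (cexp k t)).
Proof.
split; [exact: is_derive_continuous (is_derive_Re_cexp k)|
        exact: is_derive_continuous (is_derive_Im_cexp k)].
Qed.

Lemma continuous_ik_cexp k :
  continuous (fun t => Re (ik k * cexp k t)) /\ continuous (fun t => Im (ik k * cexp k t)).
Proof.
have [c1 c2] := continuous_cexp k; split => t.
  rewrite (_ : (fun t => _) = fun t => Re (ik k) * Re (cexp k t) - Im (ik k) * Im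
    (cexp k t)); last first.
    by apply/funext => s; rewrite !ReImE.
  by apply: cvgB; apply: cvgM; try exact: cvg_cst; [exact: c1|exact: c2].
rewrite (_ : (fun t => _) = fun t => Re (ik k) * Im (cexp k t) + Im (ik k) * Re
  (cexp k t)); last first.
  by apply/funext => s; rewrite !ReImE.
by apply: cvgD; apply: cvgM; try exact: cvg_cst; [exact: c2|exact: c1].
Qed.

Lemma cmeas_cexp k : cmeas (cexp k).
Proof. by have [? ?] := continuous_cexp k; split; exact: continuous_measurable_fun. Qed.

Lemma cintegral_setU D D' f : measurable D -> measurable D' ->
  cintble (D `|` D') f -> [disjoint D & D'] ->
  cintegral (D `|` D') f = cintegral D f + cintegral D' f.
Proof.
by move=> mD mD' [f1 f2] dD; apply: complex_eqP; rewrite !ReImE /= Rintegral_setU.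
Qed.

Lemma cintbleS D D' f : measurable D -> measurable D' -> D' `<=` D ->
  cintble D f -> cintble D' f.
Proof. by move=> mD mD' s [f1 f2]; split; [exact: rintbleS f1|exact: rintbleS f2]. Qed.

Lemma mu_preserving_sub (x : R) : mu_preserving (fun t => x - t).
Proof.
rewrite (_ : (fun t => _) = (fun t => t + x) \o (fun t : R => - t)).
  by apply: mu_preserving_comp; [exact: mu_preserving_shift|exact: mu_preserving_opp].
by apply/funext => t /=; rewrite addrC.
Qed.

Lemma preimage_shift (x : R) : (fun t => t + x) @^-1` `[x, +oo[%classic = `[0, +oo[%classic.
Proof. by apply/seteqP; split => t /=; rewrite !in_itv/= !andbT lerDr. Qed.

Lemma preimage_sub (x : R) : (fun t => x - t) @^-1` `]-oo, x[%classic = `]0, +oo[%classic.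
Proof. by apply/seteqP; split => t /=; rewrite !in_itv/= !andbT ltrBlDr ltrDl. Qed.

Lemma line_setU (x : R) : `[x, +oo[%classic `|` `]-oo, x[%classic = [set: R].
Proof.
by apply/seteqP; split => // t _ /=; rewrite !in_itv/= andbT; case: leP; [left|right].
Qed.

Lemma line_disj (x : R) : [disjoint `[x, +oo[%classic & `]-oo, x[%classic].
Proof.
rewrite disj_set2E; apply/eqP/seteqP; split => // t /=; rewrite !in_itv/= andbT => -[h].
by rewrite ltNge h.
Qed.

Lemma rintble_split (h : R -> R) : measurable_fun setT h ->
  rintble `[0, +oo[ h -> rintble `[0, +oo[ (fun t => h (- t)) -> rintble setT h.
Proof.
move=> mh h1 h2.
have h3 : rintble `]-oo, 0[ h.
  have h2' : rintble `]0, +oo[ (fun t => h (- t)).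
    by apply: rintbleS h2 => // t /=; rewrite !in_itv/= !andbT; exact: ltW.
  have [+ _] := Rintegral_mu_preserving_set (measurable_itv _) (mu_preserving_opp R) h2'.
  congr rintble; last by apply/funext => t /=; rewrite opprK.
  by apply/seteqP; split => t /=; rewrite !in_itv/= !andbT oppr_gt0.
apply/integrableP; split; first exact/measurable_EFinP.
rewrite -(line_setU 0) ge0_integral_setU//.
- by rewrite lte_add_pinfty//; [case/integrableP: h1|case/integrableP: h3].
- by rewrite line_setU; apply: measurableT_comp => //; exact/measurable_EFinP.
- exact: line_disj.
Qed.

Lemma cintegral_obnd_cbnd (x : R) f : cintble `[x, +oo[ f ->
  cintegral `]x, +oo[ f = cintegral `[x, +oo[ f.
Proof.
move=> fi; have [f1 f2] : cintble `]x, +oo[ f.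
  by apply: cintbleS fi => // t /=; rewrite !in_itv/= !andbT; exact: ltW.
by apply: complex_eqP => /=; rewrite Rintegral_itv_obnd_cbnd.
Qed.

Section PositiveImaginaryPart.
Variable k : R[i].
Hypothesis k0 : 0 < Im k.

Lemma cintegral_cexp s : cintble `[s, +oo[ (fun t => ik k * cexp k t) /\
  cintegral `[s, +oo[ (fun t => ik k * cexp k t) = - cexp k s.
Proof.
have [c1 c2] := continuous_ik_cexp k.
have h1 (t : R) : `|Re (ik k * cexp k t)| <= normc k * expR (- (Im k * t)).
  by rewrite -normc_cexp -normc_ik -normcM normr_Re_le.
have h2 (t : R) : `|Im (ik k * cexp k t)| <= normc k * expR (- (Im k * t)).
  by rewrite -normc_cexp -normc_ik -normcM normr_Im_le.
have h3 (t : R) : `|Re (cexp k t)| <= expR (- (Im k * t)) by rewrite -normc_cexp normr_Re_le.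
have h4 (t : R) : `|Im (cexp k t)| <= expR (- (Im k * t)) by rewrite -normc_cexp normr_Im_le.
have [i1 e1] := decay_ftc_infty k0 c1 (is_derive_Re_cexp k) h1 h3 s.
have [i2 e2] := decay_ftc_infty k0 c2 (is_derive_Im_cexp k) h2 h4 s.
by split => //; apply: complex_eqP; rewrite !ReImE.
Qed.

(** The bound on [F] squares to decay at rate 2 Im k, so [F] is square integrable on the half-line,
    as is [a]. *)
Lemma rintble_mul_decay (a F : R -> R) (K : R) : measurable_fun setT a ->
  rintble setT (fun t => a t ^+ 2) -> measurable_fun setT F ->
  (forall t, `|F t| <= K * expR (- (Im k * t))) -> rintble `[0, +oo[ (fun t => a t * F t).
Proof.
move=> ma ia mF hF; apply: rintble_mul => //; first exact: rintbleS ia.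
have k20 : 0 < 2 * Im k by rewrite mulr_gt0.
have [i1 _] := rintble_expR_decay 0 k20.
apply: (@rintble_dom _ _ _ (fun t => K ^+ 2 * expR (- (2 * Im k * t)))) => //.
- exact: measurable_funX.
- exact: rintbleZ.
- move=> t _; rewrite ger0_norm ?sqr_ge0// -(real_normK (num_real (F t))).
  have -> : K ^+ 2 * expR (- (2 * Im k * t)) = (K * expR (- (Im k * t))) ^+ 2.
    by rewrite exprMn -expRM_natl; congr (_ * expR _); ring.
  by rewrite ler_pXn2r ?nnegrE// (le_trans _ (hF t)).
Qed.

(** Formally the integral of the derivative of u(t) exp(ikt) from 0 to infinity, with no boundary
    term at infinity. The real [ibp_half] is used for the four pairings of real and imaginary parts,
    which are then recombined. *)
Lemma half_line_identity u u' : isLp 2%:E u -> isLp 2%:E u' ->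
  (forall y, 0 <= y -> u y - u 0 = cintegral `[0, y] u') ->
  cintble `[0, +oo[ (fun t => u' t * cexp k t + u t * (ik k * cexp k t)) /\
  cintegral `[0, +oo[ (fun t => u' t * cexp k t + u t * (ik k * cexp k t)) = - u 0.
Proof.
move=> hu hu' uE.
have [mu1 mu2] := isLp2_cmeas hu; have [mv1 mv2] := isLp2_cmeas hu'.
have [iu1 iu2] := isLp2_ReIm hu; have [iv1 iv2] := isLp2_ReIm hu'.
have [c1 c2] := continuous_ik_cexp k; have [d1 d2] := continuous_cexp k.
have h1 (t : R) : `|Re (ik k * cexp k t)| <= normc k * expR (- (Im k * t)).
  by rewrite -normc_cexp -normc_ik -normcM normr_Re_le.
have h2 (t : R) : `|Im (ik k * cexp k t)| <= normc k * expR (- (Im k * t)).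
  by rewrite -normc_cexp -normc_ik -normcM normr_Im_le.
have h3 (t : R) : `|Re (cexp k t)| <= 1 * expR (-
  (Im k * t)) by rewrite mul1r -normc_cexp normr_Re_le.
have h4 (t : R) : `|Im (cexp k t)| <= 1 * expR (-
  (Im k * t)) by rewrite mul1r -normc_cexp normr_Im_le.
have h3' (t : R) : `|Re (cexp k t)| <= expR (- (Im k * t)) by rewrite -normc_cexp normr_Re_le.
have h4' (t : R) : `|Im (cexp k t)| <= expR (- (Im k * t)) by rewrite -normc_cexp normr_Im_le.
have h5 (t : R) : `|expR (- (Im k * t))| <= 1 * expR (-
  (Im k * t)) by rewrite mul1r ger0_norm ?expR_ge0.
have mE : measurable_fun setT (fun t => expR (- (Im k * t))).
  by apply: continuous_measurable_fun; exact: continuous_expR_decay.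
have cm (h : R -> R) : continuous h -> measurable_fun setT h by exact:
  continuous_measurable_fun.
have uER y : 0 <= y -> Re (u y) - Re (u 0) = \int[mu]_(t in `[0, y]) Re (u' t).
  by move=> y0; have := congr1 Re (uE _ y0); rewrite !ReImE.
have uEI y : 0 <= y -> Im (u y) - Im (u 0) = \int[mu]_(t in `[0, y]) Im (u' t).
  by move=> y0; have := congr1 Im (uE _ y0); rewrite !ReImE.
have dec := rintble_mul_decay.
have iRR := rintbleD (measurable_itv _) (dec _ _ _ mv1 iv1 (cm _ d1) h3)
  (dec _ _ _ mu1 iu1 (cm _ c1) h1).
have iII := rintbleD (measurable_itv _) (dec _ _ _ mv2 iv2 (cm _ d2) h4)
  (dec _ _ _ mu2 iu2 (cm _ c2) h2).
have iRI := rintbleD (measurable_itv _) (dec _ _ _ mv1 iv1 (cm _ d2) h4)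
  (dec _ _ _ mu1 iu1 (cm _ c2) h2).
have iIR := rintbleD (measurable_itv _) (dec _ _ _ mv2 iv2 (cm _ d1) h3)
  (dec _ _ _ mu2 iu2 (cm _ c1) h1).
have RR : \int[mu]_(t in `[0, +oo[) (Re (u' t) * Re (cexp k t) + Re (u t) * Re
  (ik k * cexp k t)) =
    - (Re (u 0) * Re (cexp k 0)).
  apply: (@ibp_half _ (Re \o u) (Re \o u') _ _ (Im k) (normc k)) => //;
    first [exact: is_derive_Re_cexp|by apply: dec => //; exact: cm].
have II : \int[mu]_(t in `[0, +oo[) (Im (u' t) * Im (cexp k t) + Im (u t) * Im
  (ik k * cexp k t)) =
    - (Im (u 0) * Im (cexp k 0)).
  apply: (@ibp_half _ (Im \o u) (Im \o u') _ _ (Im k) (normc k)) => //;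
    first [exact: is_derive_Im_cexp|by apply: dec => //; exact: cm].
have RI : \int[mu]_(t in `[0, +oo[) (Re (u' t) * Im (cexp k t) + Re (u t) * Im
  (ik k * cexp k t)) =
    - (Re (u 0) * Im (cexp k 0)).
  apply: (@ibp_half _ (Re \o u) (Re \o u') _ _ (Im k) (normc k)) => //;
    first [exact: is_derive_Im_cexp|by apply: dec => //; exact: cm].
have IR : \int[mu]_(t in `[0, +oo[) (Im (u' t) * Re (cexp k t) + Im (u t) * Re
  (ik k * cexp k t)) =
    - (Im (u 0) * Re (cexp k 0)).
  apply: (@ibp_half _ (Im \o u) (Im \o u') _ _ (Im k) (normc k)) => //;
    first [exact: is_derive_Re_cexp|by apply: dec => //; exact: cm].
have ReE : Re \o (fun t => u' t * cexp k t + u t * (ik k * cexp k t)) = (fun t =>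
    (Re (u' t) * Re (cexp k t) + Re (u t) * Re (ik k * cexp k t)) -
    (Im (u' t) * Im (cexp k t) + Im (u t) * Im (ik k * cexp k t))).
  by apply/funext => t; rewrite [LHS]/= ReD ReM [Re (u t * _)]ReM; ring.
have ImE : Im \o (fun t => u' t * cexp k t + u t * (ik k * cexp k t)) = (fun t =>
    (Re (u' t) * Im (cexp k t) + Re (u t) * Im (ik k * cexp k t)) +
    (Im (u' t) * Re (cexp k t) + Im (u t) * Re (ik k * cexp k t))).
  by apply/funext => t; rewrite [LHS]/= ImD ImM [Im (u t * _)]ImM; ring.
have iR := rintbleB (measurable_itv _) iRR iII.
have iI := rintbleD (measurable_itv _) iRI iIR.
split; first by split; rewrite ?ReE ?ImE.
have e0 := cexp0 k.
apply: complex_eqP; rewrite !ReImE /=.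
  transitivity (Rintegral mu `[0, +oo[ (Re \o (fun t => u' t * cexp k t + u t *
    (ik k * cexp k t)))) => //.
  rewrite ReE RintegralB// RR II e0 /=; ring.
transitivity (Rintegral mu `[0, +oo[ (Im \o (fun t => u' t * cexp k t + u t *
  (ik k * cexp k t)))) => //.
rewrite ImE RintegralD// RI IR e0 /=; ring.
Qed.

End PositiveImaginaryPart.

(** Both halves are carried to the half-line at the origin, the left one by reflection. It stays
    open because [x] itself goes to the right half, in agreement with the test [x <= y] in
    [dgreen]. *)
Lemma cintegral_split (x : R) f : cintble setT f ->
  cintegral setT f = cintegral `[0, +oo[ (fun t => f (t + x)) +
                     cintegral `]0, +oo[ (fun t => f (x - t)).
Proof.
move=> fi.
have e : cintegral (`[x, +oo[ `|` `]-oo, x[) f = cintegral `[x, +oo[ f + cintegral `]-oo, x[ f.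
  by apply: cintegral_setU; rewrite ?line_setU//; exact: line_disj.
rewrite -[X in cintegral X f](line_setU x) e.
have f1 : cintble `[x, +oo[ f by exact: cintbleS fi.
have f2 : cintble `]-oo, x[ f by exact: cintbleS fi.
rewrite -(cintegral_mu_preserving (measurable_itv _)
  (mu_preserving_shift x) f1) preimage_shift.
by rewrite -(cintegral_mu_preserving (measurable_itv _) (mu_preserving_sub x) f2) preimage_sub.
Qed.

(* [- 2 i k] times the integral kernel of [(- d^2/dy^2 - k^2)^-1]. *)
Definition green (k : R[i]) (x y : R) : R[i] := cexp k `|y - x|.

(* Weak derivative of [green] in [y]; the value at [y = x] is irrelevant. *)
Definition dgreen (k : R[i]) (x y : R) : R[i] :=
  if x <= y then ik k * green k x y else - (ik k * green k x y).

Section Green.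
Variable k : R[i].
Hypothesis k0 : 0 < Im k.
Variable x : R.

Lemma normc_green y : normc (green k x y) = expR (- (Im k * `|y - x|)).
Proof. exact: normc_cexp. Qed.

Lemma normc_dgreen y : normc (dgreen k x y) = normc k * normc (green k x y).
Proof. by rewrite /dgreen; case: ifP => _; rewrite ?normcN normcM normc_ik. Qed.

Lemma green_right t : 0 <= t -> green k x (t + x) = cexp k t.
Proof. by move=> t0; rewrite /green addrK ger0_norm. Qed.

Lemma green_left t : 0 <= t -> green k x (x - t) = cexp k t.
Proof. by move=> t0; rewrite /green addrC addrA addNr add0r normrN ger0_norm. Qed.

Lemma dgreen_right t : 0 <= t -> dgreen k x (t + x) = ik k * cexp k t.
Proof. by move=> t0; rewrite /dgreen lerDr t0 green_right. Qed.

Lemma dgreen_left t : 0 < t -> dgreen k x (x - t) = - (ik k * cexp k t).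
Proof. by move=> t0; rewrite /dgreen lerBrDr gerDl leNgt t0 /= green_left// ltW. Qed.

Lemma cmeas_green : cmeas (green k x).
Proof.
apply: (cmeas_comp (phi := fun y => `|y - x|)); last exact: cmeas_cexp.
by apply: measurableT_comp => //; exact: measurable_funB.
Qed.

Lemma cmeas_dgreen : cmeas (dgreen k x).
Proof.
pose s (y : R) : R[i] := if x <= y then 1 else -1.
have ms : cmeas s.
  have h : measurable_fun setT (fun y : R => if x <= y then 1 else -1 : R).
    by apply: measurable_fun_ifT => //; exact: measurable_fun_ler.
  split; [rewrite (_ : _ \o _ = (fun y : R => if x <= y then 1 else -1 : R))//|
          rewrite (_ : _ \o _ = cst 0)//];
  by apply/funext => y; rewrite /= /s; case: ifP; rewrite //= oppr0.
rewrite (_ : dgreen k x = (fun y => s y * (ik k * green k x y))).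
  by apply: cmeasM => //; apply: cmeasM; [exact: cmeas_cst|exact: cmeas_green].
by apply/funext => y; rewrite /dgreen /s; case: ifP; rewrite ?mul1r ?mulN1r.
Qed.

Lemma rintble_expR_abs (c : R) : 0 < c ->
  rintble setT (fun y => expR (- (c * `|y - x|))) /\
  (\int[mu]_y expR (- (c * `|y - x|))) = 2 / c.
Proof.
move=> c0; pose h (t : R) := expR (- (c * `|t|)).
have [i e] := rintble_expR_decay 0 c0.
have eh : {in `[0, +oo[%classic, (fun t => expR (- (c * t))) =1 h}.
  by move=> t; rewrite mem_setE in_itv/= andbT /h => t0; rewrite ger0_norm.
have mh : measurable_fun setT h.
  apply: (measurableT_comp (f := fun t => expR (- (c * t)))) => //.
  by apply: continuous_measurable_fun; exact: continuous_expR_decay.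
have ih : rintble `[0, +oo[ h.
  by apply: eq_integrable i => // t /eh; rewrite /= => ->.
have hN : (fun t => h (- t)) = h by apply/funext => t; rewrite /h normrN.
have iT : rintble setT h by apply: rintble_split; rewrite ?hN.
have e1 : (fun y => expR (- (c * `|y - x|))) = h \o (fun y => y + - x) by [].
rewrite e1; split; first exact: (rintble_mu_preserving (mu_preserving_shift (- x)) iT).
rewrite (Rintegral_mu_preserving (mu_preserving_shift (- x)) iT).
have iC : cintble setT (fun t => (h t)%:C).
  by split => //; exact: (@integrable0 _ _ _ mu setT).
have := congr1 Re (cintegral_split 0 iC); rewrite ReD /= => ->.
have e2 : \int[mu]_(t in `[0, +oo[) h t = c^-1.
  have -> : c^-1 = expR (- (c * 0)) / c by rewrite mulr0 oppr0 expR0 mul1r.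
  by rewrite -e; apply: eq_Rintegral => t t0; rewrite -eh.
under eq_Rintegral do rewrite addr0.
under [X in _ + X]eq_Rintegral => t _ do rewrite add0r -[h _]/((fun t => h (- t)) t) hN.
by rewrite Rintegral_itv_obnd_cbnd ?e2; [ring|apply: rintbleS ih => // t /=;
  rewrite !in_itv/= !andbT; exact: ltW].
Qed.

(** This norm is the origin of the factor 1/sqrt(Im k) in the resolvent bound. *)
Lemma isLp2_green : isLp 2%:E (green k x) /\ L2norm (green k x) ^+ 2 = (Im k)^-1.
Proof.
have k20 : 0 < 2 * Im k by rewrite mulr_gt0.
have [i e] := rintble_expR_abs k20.
have eq y : normc (green k x y) ^+ 2 = expR (- (2 * Im k * `|y - x|)).
  by rewrite normc_green -expRM_natl; congr expR; ring.
split.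
  apply/isLp2P; split; first exact: cmeas_green.
  by under eq_fun do rewrite eq.
rewrite L2norm_sqr; under eq_Rintegral do rewrite eq.
by rewrite e; field; rewrite gt_eqF.
Qed.

Lemma isLp2_dgreen : isLp 2%:E (dgreen k x).
Proof.
have [/isLp2P[_ i] _] := isLp2_green.
apply/isLp2P; split; first exact: cmeas_dgreen.
by under eq_fun do rewrite normc_dgreen exprMn; exact: rintbleZ.
Qed.

Lemma L2norm_dgreen : L2norm (dgreen k x) ^+ 2 = normc k ^+ 2 / Im k.
Proof.
have [/isLp2P[_ i] e] := isLp2_green.
rewrite L2norm_sqr; under eq_Rintegral do rewrite normc_dgreen exprMn.
by rewrite RintegralZl// -L2norm_sqr e.
Qed.

End Green.
End Kernel.

(** * Point evaluation on H^1 through the Green kernel *)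

Section Representation.
Variable R : realType.
Notation mu := (@lebesgue_measure R).
Implicit Types (f g u v : R -> R[i]) (D : set R) (a z w : R[i]).
Local Notation "z ^*" := (Num.conj z).
Local Notation Re := (@complex.Re R).
Local Notation Im := (@complex.Im R).

Lemma cintbleN D f : measurable D -> cintble D f -> cintble D (fun t => - f t).
Proof.
move=> mD /(cintbleZ (-1) mD); congr cintble; by apply/funext => t; rewrite mulN1r.
Qed.

Lemma cintegralN D f : measurable D -> cintble D f ->
  cintegral D (fun t => - f t) = - cintegral D f.
Proof.
move=> mD fi; rewrite -mulN1r -cintegralZ//.
by apply: eq_cintegral => t _; rewrite mulN1r.
Qed.

Lemma cintegral_obnd_eq (s : R) f g : cintble `[s, +oo[ g -> (forall t, s < t -> f t = g t) ->
  cintegral `]s, +oo[ f = cintegral `[s, +oo[ g.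
Proof.
move=> gi fg; rewrite -cintegral_obnd_cbnd//; apply: eq_cintegral => t.
by rewrite mem_setE in_itv/= andbT => /fg.
Qed.

Lemma isLp2_mu_preserving (phi : R -> R) f : mu_preserving phi -> isLp 2%:E f ->
  isLp 2%:E (f \o phi).
Proof.
move=> hp /isLp2P[mf fi]; apply/isLp2P; split.
  exact: cmeas_comp (mu_preserving_meas hp) mf.
exact: (rintble_mu_preserving hp fi).
Qed.

Section Green.
Variable k : R[i].
Hypothesis k0 : 0 < Im k.
Variable x : R.

Lemma cintble_dgreen : cintble setT (dgreen k x).
Proof.
have [i _] := rintble_expR_abs x k0.
apply: cintble_dom (rintbleZ (normc k) measurableT i) _ => //; first exact: cmeas_dgreen.
by move=> t _; rewrite normc_dgreen normc_green.
Qed.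

(** The kernel is even about [x], so its derivative is odd: the two half-lines contribute -1 and
    1. *)
Lemma cintegral_dgreen0 : cintegral setT (dgreen k x) = 0.
Proof.
have [i e] := cintegral_cexp k0 0.
rewrite (cintegral_split x cintble_dgreen).
have -> : cintegral `[0, +oo[ (fun t => dgreen k x (t + x)) = - cexp k 0.
  rewrite -e; apply: eq_cintegral => t; rewrite mem_setE in_itv/= andbT; exact: dgreen_right.
rewrite (@cintegral_obnd_eq 0 _ (fun t => - (ik k * cexp k t))).
- by rewrite cintegralN// e opprK addNr.
- exact: cintbleN.
- exact: dgreen_left.
Qed.

(** The fundamental theorem of calculus from infinity, across the corner at [x]. To the right of [x]
    it is the exponential case; to the left the corner is avoided by passing to the complementary
    half-line. *)
Lemma cintegral_dgreen s : cintegral `[s, +oo[ (dgreen k x) = - green k x s.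
Proof.
have di := cintble_dgreen.
have [xs|sx] := leP x s.
  have -> : green k x s = cexp k (s - x) by rewrite /green ger0_norm ?subr_ge0.
  have [_ <-] := cintegral_cexp k0 (s - x).
  have d1 : cintble `[s, +oo[ (dgreen k x) by exact: cintbleS di.
  rewrite -(cintegral_mu_preserving (measurable_itv _) (mu_preserving_shift x) d1).
  have -> : (fun t => t + x) @^-1` `[s, +oo[%classic = `[s - x, +oo[%classic.
    by apply/seteqP; split => t /=; rewrite !in_itv/= !andbT lerBlDr.
  apply: eq_cintegral => t; rewrite mem_setE in_itv/= andbT => st.
  by rewrite /= dgreen_right// (le_trans _ st)// subr_ge0.
have -> : green k x s = cexp k (x - s).
  by rewrite /green distrC gtr0_norm ?subr_gt0.
have [i e] := cintegral_cexp k0 (x - s).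
(* Since the total integral vanishes, the part over [s, +oo[ is minus the part over ]-oo, s[, where
   the kernel is a single reflected exponential. *)
have := cintegral_dgreen0; rewrite -[X in cintegral X _](line_setU s) cintegral_setU//;
  first last.
- exact: line_disj.
- by rewrite line_setU.
have d2 : cintble `]-oo, s[ (dgreen k x) by exact: cintbleS di.
rewrite -(cintegral_mu_preserving (measurable_itv _) (mu_preserving_sub x) d2).
have -> : (fun t => x - t) @^-1` `]-oo, s[%classic = `]x - s, +oo[%classic.
  by apply/seteqP; split => t /=; rewrite !in_itv/= !andbT ltrBlDr ltrBlDl addrC.
rewrite (@cintegral_obnd_eq _ _ (fun t => - (ik k * cexp k t))); first last.
- by move=> t st /=; rewrite dgreen_left// (lt_trans _ st)// subr_gt0.
- exact: cintbleN.
by rewrite cintegralN// e opprK => /eqP; rewrite addr_eq0 => /eqP.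
Qed.

(** Makes the Green kernel an admissible test function in the weak equation. *)
Lemma isH1_green : isH1 (green k x) (dgreen k x).
Proof.
split; [by have [] := isLp2_green k0 x|exact: isLp2_dgreen|].
move=> a b ab; have [d1 d2] := cintble_dgreen.
have r1 : rintble `[a, +oo[ (Re \o dgreen k x) by exact: rintbleS d1.
have r2 : rintble `[a, +oo[ (Im \o dgreen k x) by exact: rintbleS d2.
have e : cintegral `[a, +oo[ (dgreen k x) - cintegral `[a, b] (dgreen k x) =
         cintegral `[b, +oo[ (dgreen k x).
  rewrite -[RHS]cintegral_obnd_cbnd; last exact: cintbleS cintble_dgreen.
  have b1 : (BLeft a <= BRight b)%O by rewrite bnd_simp.
  have b2 : (BRight b <= +oo)%O by rewrite bnd_simp.
  have e1 := @Rintegral_itvB R (Re \o dgreen k x) (BLeft a) +oo%O b r1 b1 b2.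
  have e2 := @Rintegral_itvB R (Im \o dgreen k x) (BLeft a) +oo%O b r2 b1 b2.
  by apply: complex_eqP; [rewrite ReD ReN; exact: e1|rewrite ImD ImN; exact: e2].
move: e; rewrite !cintegral_dgreen => /eqP; rewrite subr_eq => /eqP e.
by rewrite e addrA subrr add0r.
Qed.

End Green.

Lemma cintble_isLp2_itv f (a b : R) : isLp 2%:E f -> cintble `[a, b] f.
Proof.
by move=> hf; have [f1 f2] := isLp2_ReIm hf; have [m1 m2] := isLp2_cmeas hf;
  split; exact: rintble_sqr_itv.
Qed.

Lemma isH1J u u' : isH1 u u' -> isH1 (fun t => (u t)^*) (fun t => (u' t)^*).
Proof.
move=> [h1 h2 h3]; split; [exact: isLp2J|exact: isLp2J|].
by move=> a b ab; rewrite -raddfB h3// cintegralJ//; exact: cintble_isLp2_itv.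
Qed.

(** The weak form of -g'' - k^2 g = -2ik delta_x for g = [green k x], tested on [u]. Each side of
    [x] contributes -ik u(x). *)
Lemma green_representation k x u u' : 0 < Im k -> isH1 u u' ->
  cintegral setT (fun t => u' t * dgreen k x t) -
  k * k * cintegral setT (fun t => u t * green k x t) = - (2 * ik k * u x).
Proof.
move=> k0 [hu hu' uE].
have [hg _] := isLp2_green k0 x; have hd := isLp2_dgreen k0 x.
have i1 := cintbleM hu' hd; have i2 := cintbleM hu hg.
rewrite -cintegralZ// -cintegralB//; last exact: cintbleZ.
rewrite (cintegral_split x); last by rewrite /=; apply: cintbleD => //;
  apply: cintbleN => //; exact: cintbleZ.
have ms := mu_preserving_shift x; have mb := mu_preserving_sub x.
have [j1 e1] : cintble `[0, +oo[ (fun t => u' (t + x) * cexp k t + u (t + x) *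
  (ik k * cexp k t)) /\
  cintegral `[0, +oo[ (fun t => u' (t + x) * cexp k t + u (t + x) * (ik k * cexp k t)) = - u x.
  have -> : u x = (u \o (fun t => t + x)) 0 by rewrite /= add0r.
  apply: (half_line_identity k0 (isLp2_mu_preserving ms hu)
    (isLp2_mu_preserving ms hu')) => y y0.
  rewrite /= add0r uE ?lerDr//.
  rewrite -(cintegral_mu_preserving (measurable_itv _) ms (cintble_isLp2_itv _ _ hu')).
  congr cintegral; apply/seteqP; split => t /=; by rewrite !in_itv/= lerDr lerD2r.
(* Reflection changes the sign of the derivative: that of u(x - t) is -u'(x - t). *)
have [j2 e2] : cintble `[0, +oo[ (fun t => - u' (x - t) * cexp k t + u (x - t) *
  (ik k * cexp k t)) /\
  cintegral `[0, +oo[ (fun t => - u' (x - t) * cexp k t + u (x - t) *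
    (ik k * cexp k t)) = - u x.
  have -> : u x = (u \o (fun t => x - t)) 0 by rewrite /= subr0.
  have hN : isLp 2%:E (fun t => - u' (x - t)).
    have := isLp2Z (-1) (isLp2_mu_preserving mb hu').
    by congr isLp; apply/funext => t; rewrite mulN1r.
  apply: (half_line_identity k0 (isLp2_mu_preserving mb hu) hN) => y y0.
  rewrite cintegralN//; last exact: (cintble_isLp2_itv _ _ (isLp2_mu_preserving mb hu')).
  rewrite /= subr0 -[LHS]opprB uE ?gerBl//; congr (- _).
  rewrite -(cintegral_mu_preserving (measurable_itv _) mb (cintble_isLp2_itv _ _ hu')).
  congr cintegral; apply/seteqP; split => t /=; rewrite !in_itv/=; lra.
(* As (ik)^2 = -k^2, a common factor ik splits off and leaves the integrand of
   [half_line_identity]. *)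
have -> : cintegral `[0, +oo[ (fun t => u' (t + x) * dgreen k x (t + x) - k * k * (u
  (t + x) * green k x (t + x)))
  = ik k * - u x.
  rewrite -e1 -cintegralZ//; apply: eq_cintegral => t; rewrite mem_setE in_itv/= andbT => t0.
  rewrite dgreen_right// green_right// -[k * k]opprK -ik_sqr; ring.
rewrite (@cintegral_obnd_eq _ _ (fun t => ik k * (- u' (x - t) * cexp k t + u (x - t) *
  (ik k * cexp k t)))).
- by rewrite cintegralZ// e2; ring.
- exact: cintbleZ.
- move=> t t0; rewrite dgreen_left// green_left ?ltW// -[k * k]opprK -ik_sqr; ring.
Qed.

(** The Sobolev embedding, read off from the representation at k = i: there the kernel and its
    derivative both have L^2 norm 1, so 2|u(x)| <= ||u'|| + ||u||. *)
Lemma isH1_bounded u u' : isH1 u u' -> exists2 M, 0 <= M & forall x, normc (u x) <= M.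
Proof.
move=> h; have [hu hu' _] := h.
pose k : R[i] := 0 +i* 1.
have k0 : 0 < Im k by rewrite /= ltr01.
have kn : normc k = 1 by rewrite normc_sqrt /= expr0n expr1n add0r sqrtr1.
have kk : normc (k * k) = 1 by rewrite normcM kn mulr1.
exists (L2norm u' + L2norm u); first by rewrite addr_ge0// L2norm_ge0.
move=> x; have [hg eg] := isLp2_green k0 x; have hd := isLp2_dgreen k0 x.
have ed := L2norm_dgreen k0 x.
have g1 : L2norm (green k x) = 1.
  by apply/eqP; rewrite -(@eqrXn2 _ 2)// ?L2norm_ge0// eg /= invr1 expr1n.
have d1 : L2norm (dgreen k x) = 1.
  by apply/eqP; rewrite -(@eqrXn2 _ 2)// ?L2norm_ge0// ed kn /= invr1 mulr1.
have := congr1 (@normc R) (green_representation x k0 h).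
rewrite normcN !normcM normc_ik kn mulr1.
have -> : normc (2 : R[i]) = 2 by rewrite normc_sqrt /= addr0 expr0n addr0 sqrtr_sqr ger0_norm.
move=> e; have := le_normcB (cintegral setT (fun t => u' t * dgreen k x t))
  (k * k * cintegral setT (fun t => u t * green k x t)).
rewrite normcM kk mul1r e.
have := le_cintegralM hu' hd; have := le_cintegralM hu hg; rewrite g1 d1 !mulr1.
have := normc_ge0 (u x); lra.
Qed.

End Representation.

(** * The operator and its resolvent *)

Section Operator.
Variables (R : realType) (V : R -> R[i]).
Notation mu := (@lebesgue_measure R).
Implicit Types (f g u v w : R -> R[i]) (D : set R) (a z : R[i]).
Local Notation "z ^*" := (Num.conj z).
Local Notation Re := (@complex.Re R).
Local Notation Im := (@complex.Im R).
Hypothesis hV : isLp 1%:E V.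

Lemma isH1_lin u u' v v' a : isH1 u u' -> isH1 v v' ->
  isH1 (fun t => a * u t + v t) (fun t => a * u' t + v' t).
Proof.
move=> [u1 u2 u3] [v1 v2 v3]; split; [exact: isLp2_lin|exact: isLp2_lin|].
move=> x y xy; rewrite cintegral_lin//; [|exact: cintble_isLp2_itv..].
by rewrite -u3// -v3//; ring.
Qed.

Lemma isH1_0 : isH1 (cst 0 : R -> R[i]) (cst 0).
Proof. by split; [exact: isLp2_0|exact: isLp2_0|move=> x y _; rewrite cintegral0 subrr]. Qed.

Lemma cintble_V f M : cmeas f -> (forall t, normc (f t) <= M) ->
  cintble setT (fun t => V t * f t).
Proof.
move=> mf fM; have [mV iV] := (isLp1P V).1 hV.
apply: cintble_dom (rintbleZ M measurableT iV) _ => //; first exact: cmeasM.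
by move=> t _; rewrite normcM mulrC ler_wpM2r// normc_ge0.
Qed.

(** Here the Sobolev bound lets a potential that is only L^1 act in the form: the factor multiplying
    [V] is bounded. *)
Lemma cintble_Vuv u u' v v' : isH1 u u' -> isH1 v v' ->
  cintble setT (fun t => V t * u t * (v t)^*).
Proof.
move=> hu hv; have [M M0 uM] := isH1_bounded hu; have [N N0 vN] := isH1_bounded hv.
have mu' : cmeas u by case: hu => /isLp2_cmeas.
have mv' : cmeas v by case: hv => /isLp2_cmeas.
under eq_fun do rewrite -mulrA.
apply: (@cintble_V _ (M * N)); first by apply: cmeasM => //; exact: cmeasJ.
by move=> t; rewrite normcM normcJ ler_pM// normc_ge0.
Qed.

(* The weak formulation in [HV], for the H^1 representative [u0]. *)
Definition weak_eq u0 u0' f := forall v v', isH1 v v' ->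
  cintegral setT (fun t => u0' t * (v' t)^*) +
  cintegral setT (fun t => V t * u0 t * (v t)^*) =
  cintegral setT (fun t => f t * (v t)^*).

Lemma weak_eq_lin u0 u0' f w0 w0' g a : isLp 2%:E f -> isLp 2%:E g ->
  isH1 u0 u0' -> isH1 w0 w0' ->
  weak_eq u0 u0' f -> weak_eq w0 w0' g ->
  weak_eq (fun t => a * u0 t + w0 t) (fun t => a * u0' t + w0' t)
          (fun t => a * f t + g t).
Proof.
move=> hf hg hu hw eu ew v v' hv.
have [u1 u2 _] := hu; have [w1 w2 _] := hw; have [v1 v2 _] := hv.
have -> : (fun t => (a * u0' t + w0' t) * (v' t)^*) =
  (fun t => a * (u0' t * (v' t)^*) + w0' t * (v' t)^*) by apply/funext => t; ring.
have -> : (fun t => V t * (a * u0 t + w0 t) * (v t)^*) =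
  (fun t => a * (V t * u0 t * (v t)^*) + V t * w0 t * (v t)^*) by apply/funext => t; ring.
have -> : (fun t => (a * f t + g t) * (v t)^*) =
  (fun t => a * (f t * (v t)^*) + g t * (v t)^*) by apply/funext => t; ring.
rewrite !cintegral_lin//; first [exact: cintbleMJ|exact: (cintble_Vuv hu hv)|exact:
  (cintble_Vuv hw hv)|idtac].
by rewrite -(eu _ _ hv) -(ew _ _ hv); ring.
Qed.

Lemma weak_eq_ae u0 u0' f g : isLp 2%:E f -> isLp 2%:E g -> f = g %[ae mu] ->
  weak_eq u0 u0' f -> weak_eq u0 u0' g.
Proof.
move=> hf hg fg e v v' hv; rewrite (e _ _ hv); have [v1 _ _] := hv.
apply: cintegral_ae_eq.
- by apply: cmeasM; [exact: isLp2_cmeas|apply: cmeasJ; exact: isLp2_cmeas].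
- by apply: cmeasM; [exact: isLp2_cmeas|apply: cmeasJ; exact: isLp2_cmeas].
- by apply: (ae_eq_mono fg) => t ->.
Qed.

Lemma HV_lin u f w g a : HV V u f -> HV V w g ->
  HV V (fun t => a * u t + w t) (fun t => a * f t + g t).
Proof.
move=> [hf [u0 [u0' [e1 h1 h2 h3]]]] [hg [w0 [w0' [e2 k1 k2 k3]]]].
split; first exact: isLp2_lin.
exists (fun t => a * u0 t + w0 t), (fun t => a * u0' t + w0' t); split.
- by apply: (ae_eq_mono2 e1 e2) => t -> ->.
- exact: isLp2_lin.
- exact: isH1_lin.
- exact: weak_eq_lin.
Qed.

Lemma HV_ae u f w g : HV V u f -> isLp 2%:E w -> isLp 2%:E g ->
  u = w %[ae mu] -> f = g %[ae mu] -> HV V w g.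
Proof.
move=> [hf [u0 [u0' [e1 h1 h2 h3]]]] hw hg uw fg.
split => //; exists u0, u0'; split => //.
  by apply: (ae_eq_mono2 uw e1) => t -> ->.
exact: weak_eq_ae h3.
Qed.

Lemma HV_0 : HV V (cst 0) (cst 0).
Proof.
split; first exact: isLp2_0.
exists (cst 0), (cst 0); split; [exact: ae_eqxx|exact: isLp2_0|exact: isH1_0|].
move=> v v' hv.
have e f : cintegral setT (fun t => (0 : R[i]) * f t) = 0.
  by rewrite -[RHS](@cintegral0 R setT); apply: eq_cintegral => t _; rewrite mul0r.
under [X in _ + X = _]eq_cintegral => t _ do rewrite /= mulr0.
by rewrite !e addr0.
Qed.

Lemma HV_isLp2 u f : HV V u f -> isLp 2%:E u.
Proof. by move=> [_ [? [? []]]]. Qed.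

Lemma HVsub_isLp2 z u f : HVsub V z u f -> isLp 2%:E u /\ isLp 2%:E f.
Proof.
move=> h; have hu := HV_isLp2 h; split => //; have [hf _] := h.
have := isLp2_lin (- z) hu hf; congr isLp; apply/funext => t; ring.
Qed.

Lemma HVsub_lin z u f w g a : HVsub V z u f -> HVsub V z w g ->
  HVsub V z (fun t => a * u t + w t) (fun t => a * f t + g t).
Proof.
move=> h1 h2; have := HV_lin a h1 h2; congr HV; apply/funext => t; ring.
Qed.

Lemma HVsub_0 z : HVsub V z (cst 0) (cst 0).
Proof. by have := HV_0; congr HV; apply/funext => t /=; rewrite mulr0 addr0. Qed.

Lemma HVsub_ae z u f w g : HVsub V z u f -> isLp 2%:E w -> isLp 2%:E g ->
  u = w %[ae mu] -> f = g %[ae mu] -> HVsub V z w g.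
Proof.
move=> h hw hg uw fg; apply: (HV_ae h) => //.
  by apply: isLp2D => //; exact: isLp2Z.
by apply: (ae_eq_mono2 uw fg) => t -> ->.
Qed.

Lemma HVsub_sum z n (c : 'I_n -> R[i]) (u f : 'I_n -> R -> R[i]) :
  (forall i, HVsub V z (u i) (f i)) ->
  HVsub V z (fun t => \sum_(i < n) c i * u i t) (fun t => \sum_(i < n) c i * f i t).
Proof.
move=> h; suff H (s : seq 'I_n) :
    HVsub V z (fun t => \sum_(i <- s) c i * u i t) (fun t => \sum_(i <- s) c i * f i t).
  exact: H.
elim: s => [|i s ih].
  have := HVsub_0 z; congr HVsub; by apply/funext => t; rewrite big_nil.
have := HVsub_lin (c i) (h i) ih.
congr HVsub; by apply/funext => t; rewrite big_cons.
Qed.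

Lemma L1norm_V : rintble setT (fun t => normc (V t)) /\ 0 <= L1norm V.
Proof.
have [_ iV] := (isLp1P V).1 hV; split => //.
by apply: Rintegral_ge0 => t _; exact: normc_ge0.
Qed.

Lemma le_cintegral_V f M : cmeas f -> (forall t, normc (f t) <= M) ->
  normc (cintegral setT (fun t => V t * f t)) <= L1norm V * M.
Proof.
move=> mf fM; have [mV iV] := (isLp1P V).1 hV.
have i := cintble_V mf fM.
apply: le_trans (le_normc_cintegral measurableT _ i) _; first exact: cmeasM.
rewrite /L1norm -RintegralZr//; apply: le_Rintegral => //.
- by apply: rintble_normc => //; exact: cmeasM.
- by have := rintbleZ M measurableT iV; congr rintble; apply/funext => t; rewrite mulrC.
- by move=> t _; rewrite normcM ler_wpM2l// normc_ge0.
Qed.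

(** Pairing the weak equation with the Green kernel gives 2ik u(x) as the integral of V u g minus
    that of f g. Since |g| <= 1, the first is at most B sup|u|, which is moved to the left side. *)
Lemma resolvent_bound k u f u0 u0' : 0 < Im k -> isLp 2%:E u -> isLp 2%:E f ->
  u = u0 %[ae mu] -> isH1 u0 u0' -> weak_eq u0 u0' (fun t => f t + k * k * u t) ->
  L1norm V <= 2 * normc k ->
  forall x, (2 * normc k - L1norm V) * normc (u0 x) <= L2norm f / Num.sqrt (Im k).
Proof.
move=> k0 hu hf ue h0 W Vk.
have [M0 M00 hM0] := isH1_bounded h0; have [hu0 hu0' _] := h0.
(* The bound is proved with an arbitrary majorant [M] of |u0| first, so that [M] can afterwards be
   the supremum itself. *)
have pw x M : (forall y, normc (u0 y) <= M) ->
    2 * normc k * normc (u0 x) <= L2norm f / Num.sqrt (Im k) + L1norm V * M.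
  move=> hM; have [hg eg] := isLp2_green k0 x; have hd := isLp2_dgreen k0 x.
  (* The conjugate kernel is the test function, so that the conjugation in the form cancels and the
     bilinear [green_representation] applies. *)
  have := W _ _ (isH1J (isH1_green k0 x)).
  have -> : (fun t => u0' t * ((dgreen k x t)^*)^*) = (fun t => u0' t * dgreen k x t).
    by apply/funext => t; rewrite conjCK.
  have -> : (fun t => V t * u0 t * ((green k x t)^*)^*) = (fun t => V t *
    (u0 t * green k x t)).
    by apply/funext => t; rewrite conjCK mulrA.
  have -> : cintegral setT (fun t => (f t + k * k * u t) * ((green k x t)^*)^*) =
    cintegral setT (fun t => (k * k) * (u0 t * green k x t) + f t * green k x t).
    apply: cintegral_ae_eq.
    - apply: cmeasM; last by do 2 apply: cmeasJ; exact: cmeas_green.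
      by apply: isLp2_cmeas; apply: isLp2D => //; exact: isLp2Z.
    - apply: cmeasD; last by apply: cmeasM; [exact: isLp2_cmeas|exact: cmeas_green].
      apply: cmeasM; first exact: cmeas_cst.
      by apply: cmeasM; [exact: isLp2_cmeas|exact: cmeas_green].
    - by apply: (ae_eq_mono ue) => t ->; rewrite conjCK; ring.
  rewrite cintegral_lin//; [|exact: cintbleM..].
  have := green_representation x k0 h0.
  set A := cintegral _ _; set B := cintegral _ _; set C := cintegral _ _;
    set E := cintegral _ _.
  move=> e1 e2.
  have e : 2 * ik k * u0 x = C - E.
    by rewrite -[LHS]opprK -e1; apply: (addIr (A + C - k * k * B - E)); rewrite {2}e2; ring.
  have nE : normc E <= L2norm f / Num.sqrt (Im k).
    apply: le_trans (le_cintegralM hf hg) _; rewrite ler_wpM2l// ?L2norm_ge0//.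
    by rewrite -[leLHS]ger0_norm ?L2norm_ge0// -sqrtr_sqr eg sqrtrV// ltW.
  have nC : normc C <= L1norm V * M.
    apply: le_cintegral_V.
      by apply: cmeasM; [exact: isLp2_cmeas|exact: cmeas_green].
    move=> t; rewrite normcM normc_green -[leRHS]mulr1 ler_pM ?normc_ge0 ?expR_ge0//.
    by rewrite -expR0 ler_expR oppr_le0 mulr_ge0// ltW.
  have := congr1 (@normc R) e; rewrite !normcM normc_ik.
  have -> : normc (2 : R[i]) = 2 by rewrite normc_sqrt /= addr0 expr0n addr0 sqrtr_sqr
    ger0_norm.
  move=> ->; have := le_normcB C E; lra.
(* Absorbing B sup|u0| requires a finite supremum, which [isH1_bounded] supplies through [M0]. *)
pose Z := [set normc (u0 x) | x in [set: R]].
have Zs : has_sup Z.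
  split; first by exists (normc (u0 0)), 0.
  by exists M0 => _ [x _ <-]; exact: hM0.
have hM y : normc (u0 y) <= sup Z by apply: sup_upper_bound => //; exists y.
set c := L2norm f / Num.sqrt (Im k).
have nk := normc_ge0 k.
have s2 : 2 * normc k * sup Z <= c + L1norm V * sup Z.
  move: nk; rewrite le_eqVlt => /orP[/eqP <-|nk].
    rewrite mulr0 mul0r addr_ge0//; last first.
      by rewrite mulr_ge0//; [case: L1norm_V|exact: le_trans (normc_ge0 (u0 0)) (hM 0)].
    by rewrite /c mulr_ge0 ?L2norm_ge0// invr_ge0 sqrtr_ge0.
  rewrite -ler_pdivlMl ?mulr_gt0//; apply: ge_sup; first by case: Zs.
  by move=> _ [x _ <-]; rewrite ler_pdivlMl ?mulr_gt0// pw.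
move=> x; apply: (@le_trans _ _ ((2 * normc k - L1norm V) * sup Z)); last lra.
by rewrite ler_wpM2l// subr_ge0.
Qed.

End Operator.

(** * The L^2 inner product and orthonormal families *)

Section InnerProduct.
Variable (R : realType).
Notation mu := (@lebesgue_measure R).
Implicit Types (f g u v w : R -> R[i]) (a z : R[i]).
Local Notation "z ^*" := (Num.conj z).
Local Notation Re := (@complex.Re R).
Local Notation Im := (@complex.Im R).

Lemma Rintegral0 : \int[mu]_t (0 : R) = 0.
Proof. by rewrite (@Rintegral_cst _ _ _ mu setT measurableT) mul0r. Qed.

Lemma L2norm0 : L2norm (cst 0 : R -> R[i]) = 0.
Proof.
rewrite /L2norm; under eq_Rintegral do rewrite normc0 expr0n.
by rewrite Rintegral0 sqrtr0.
Qed.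

Definition ip f g : R[i] := cintegral setT (fun t => f t * (g t)^*).

Definition lincomb n (c : 'I_n -> R[i]) (f : 'I_n -> R -> R[i]) : R -> R[i] :=
  fun t => \sum_(i < n) c i * f i t.

Lemma isLp2_lincomb n c (f : 'I_n -> R -> R[i]) : (forall i, isLp 2%:E (f i)) ->
  isLp 2%:E (lincomb c f).
Proof. by move=> h; apply: isLp2_sum => i; exact: isLp2Z. Qed.

Lemma ip_lincombl n c (f : 'I_n -> R -> R[i]) g : (forall i, isLp 2%:E (f i)) ->
  isLp 2%:E g -> ip (lincomb c f) g = \sum_(i < n) c i * ip (f i) g.
Proof.
move=> hf hg; rewrite /ip /lincomb.
have -> : (fun t => (\sum_(i < n) c i * f i t) * (g t)^*) =
  (fun t => \sum_(i < n) c i * (f i t * (g t)^*)).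
  by apply/funext => t; rewrite mulr_suml; apply: eq_bigr => i _; rewrite mulrA.
rewrite cintegral_sum//; last by move=> i; apply: cintbleZ => //; exact: cintbleMJ.
by apply: eq_bigr => i _; rewrite cintegralZ//; exact: cintbleMJ.
Qed.

Lemma ipC f g : isLp 2%:E f -> isLp 2%:E g -> ip g f = (ip f g)^*.
Proof.
move=> hf hg; rewrite /ip -cintegralJ//; last exact: cintbleMJ.
by apply: eq_cintegral => t _; rewrite rmorphM/= conjCK mulrC.
Qed.

Lemma ip_lincombr n c (f : 'I_n -> R -> R[i]) g : (forall i, isLp 2%:E (f i)) ->
  isLp 2%:E g -> ip g (lincomb c f) = \sum_(i < n) (c i)^* * ip g (f i).
Proof.
move=> hf hg; rewrite ipC//; last exact: isLp2_lincomb.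
rewrite ip_lincombl// rmorph_sum; apply: eq_bigr => i _.
by rewrite rmorphM/= -ipC.
Qed.

Lemma ip_norm f : isLp 2%:E f -> ip f f = (L2norm f ^+ 2)%:C.
Proof.
move=> /isLp2P[mf i]; rewrite L2norm_sqr; apply: complex_eqP => /=.
  by apply: eq_Rintegral => t _; rewrite mulJc.
by rewrite -[RHS]Rintegral0; apply: eq_Rintegral => t _; rewrite mulJc.
Qed.

Lemma ip_ae f f' g g' : isLp 2%:E f -> isLp 2%:E f' -> isLp 2%:E g -> isLp 2%:E g' ->
  f = f' %[ae mu] -> g = g' %[ae mu] -> ip f g = ip f' g'.
Proof.
move=> hf hf' hg hg' e e'; apply: cintegral_ae_eq.
- by apply: cmeasM; [exact: isLp2_cmeas|apply: cmeasJ; exact: isLp2_cmeas].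
- by apply: cmeasM; [exact: isLp2_cmeas|apply: cmeasJ; exact: isLp2_cmeas].
- by apply: (ae_eq_mono2 e e') => t -> ->.
Qed.

Lemma L2norm_eq0 f : isLp 2%:E f -> L2norm f = 0 -> f = cst 0 %[ae mu].
Proof.
move=> /isLp2P[mf i] e.
have e2 : \int[mu]_t normc (f t) ^+ 2 = 0 by rewrite -L2norm_sqr e expr0n.
have mn : measurable_fun setT (fun t => normc (f t) ^+ 2).
  by apply: measurable_funX; exact: cmeas_normc.
have h := Rintegral_ge0_eq0 mn i (fun t => sqr_ge0 _) e2.
by apply: (ae_eq_mono h) => t /= /eqP; rewrite expf_eq0 /= normc_eq0 => /eqP.
Qed.

Lemma L2norm_ae f g : isLp 2%:E f -> isLp 2%:E g -> f = g %[ae mu] -> L2norm f = L2norm g.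
Proof.
move=> hf hg fg; apply/eqP; rewrite -(@eqrXn2 _ 2)// ?L2norm_ge0//; apply/eqP/complexI.
by rewrite -!ip_norm//; exact: ip_ae.
Qed.

Lemma ae_eq_lincomb n c (f g : 'I_n -> R -> R[i]) :
  (forall i, f i = g i %[ae mu]) -> lincomb c f = lincomb c g %[ae mu].
Proof.
move=> h; rewrite /lincomb; elim: (index_enum _) => [|i s ih].
  by apply: (ae_eq_mono (ae_eqxx (cst (0 : R)))) => t _; rewrite !big_nil.
by apply: (ae_eq_mono2 (h i) ih) => t e e'; rewrite !big_cons e e'.
Qed.

Definition orthonormal n (e : 'I_n -> R -> R[i]) :=
  (forall i, isLp 2%:E (e i)) /\ (forall i j, ip (e i) (e j) = (i == j)%:R).

Lemma ip_orthonormal n (e : 'I_n -> R -> R[i]) c j : orthonormal e ->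
  ip (lincomb c e) (e j) = c j.
Proof.
move=> [he o]; rewrite ip_lincombl// (bigD1 j)//= o eqxx mulr1 big1 ?addr0// => i ij.
by rewrite o (negbTE ij) mulr0.
Qed.

Lemma L2norm_lincomb n (e : 'I_n -> R -> R[i]) c : orthonormal e ->
  L2norm (lincomb c e) ^+ 2 = \sum_(i < n) normc (c i) ^+ 2.
Proof.
move=> o; have [he _] := o; apply: (@complexI R); rewrite -ip_norm; last exact: isLp2_lincomb.
rewrite ip_lincombr//; last exact: isLp2_lincomb.
rewrite rmorph_sum; apply: eq_bigr => i _.
by rewrite ip_orthonormal// mulrC mulJc.
Qed.

Lemma L2norm_orthonormal n (e : 'I_n -> R -> R[i]) i : orthonormal e -> L2norm (e i) = 1.
Proof.
move=> [he o]; apply/eqP; rewrite -(@eqrXn2 _ 2)// ?L2norm_ge0//; apply/eqP/complexI.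
by rewrite -ip_norm// o eqxx expr1n.
Qed.

Lemma le_ip f g : isLp 2%:E f -> isLp 2%:E g -> normc (ip f g) <= L2norm f * L2norm g.
Proof.
move=> hf hg; apply: le_trans (le_cintegralM hf (isLp2J hg)) _.
by rewrite /L2norm; under [X in _ * Num.sqrt X <= _]eq_Rintegral do rewrite normcJ.
Qed.

End InnerProduct.

(** * The resolvent at -B^2: sup bound, injectivity and trace estimate *)

Section Resolvent.
Variables (R : realType) (V : R -> R[i]).
Notation mu := (@lebesgue_measure R).
Implicit Types (f g u v w : R -> R[i]) (a z : R[i]).
Local Notation "z ^*" := (Num.conj z).
Local Notation Re := (@complex.Re R).
Local Notation Im := (@complex.Im R).
Hypothesis hV : isLp 1%:E V.
Local Notation B := (L1norm V).

Lemma eigenvalue_bound k u : 0 < Im k -> HVsub V (k * k) u (cst 0) ->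
  ~ (u = cst 0 %[ae mu]) -> 2 * normc k <= B.
Proof.
move=> k0 h u0; rewrite leNgt; apply/negP => Bk; apply: u0.
have [hu hf] := HVsub_isLp2 h.
have [_ [w [w' [e1 _ h1 W]]]] := h.
have bd := resolvent_bound hV k0 hu hf e1 h1 W (ltW Bk).
apply: (ae_eq_mono e1) => t ->; apply/eqP; rewrite -normc_eq0 eq_le normc_ge0 andbT.
have := bd t; rewrite L2norm0.
by rewrite mul0r pmulr_rle0// subr_gt0.
Qed.

Hypothesis B0 : 0 < B.
Local Notation kB := ((0 : R) +i* B).

Lemma kB_sqr : kB * kB = - (B ^+ 2)%:C.
Proof. by apply: complex_eqP; rewrite !ReImE /=; ring. Qed.

Lemma normc_kB : normc kB = B.
Proof. by rewrite normc_sqrt /= expr0n add0r sqrtr_sqr ger0_norm ?ltW. Qed.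

(** At [kB] both |k| and Im k equal B, so the coefficient 2|k| - B is again B. *)
Lemma resolvent_sup u f u0 u0' : isLp 2%:E u -> isLp 2%:E f ->
  u = u0 %[ae mu] -> isH1 u0 u0' -> weak_eq V u0 u0' (fun t => f t + kB * kB * u t) ->
  forall x, B * normc (u0 x) <= L2norm f / Num.sqrt B.
Proof.
move=> hu hf e h W x.
have B2 : B <= 2 * normc kB by rewrite normc_kB ler_peMl ?ler1n ?ltW.
have := @resolvent_bound R V hV kB u f u0 u0' B0 hu hf e h W B2 x.
by rewrite normc_kB /= [2 * B - B](_ : _ = B); last ring.
Qed.

(** Used to identify two preimages of the same function under H_V - z0, that is, to make [T] well
    defined. *)
Lemma resolvent_inj u f : HVsub V (kB * kB) u f -> f = cst 0 %[ae mu] -> u = cst 0 %[ae mu].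
Proof.
move=> h f0; have [hu hf] := HVsub_isLp2 h.
have [_ [w [w' [e1 _ h1 W]]]] := h.
have bd := resolvent_sup hu hf e1 h1 W.
apply: (ae_eq_mono e1) => t ->; apply/eqP; rewrite -normc_eq0 eq_le normc_ge0 andbT.
have := bd t; rewrite (L2norm_ae hf (isLp2_0 R) f0).
by rewrite L2norm0 mul0r pmulr_rle0.
Qed.

Lemma Rintegral_sum n (F : 'I_n -> R -> R) : (forall i, rintble setT (F i)) ->
  rintble setT (fun t => \sum_(i < n) F i t) /\
  \int[mu]_t (\sum_(i < n) F i t) = \sum_(i < n) \int[mu]_t F i t.
Proof.
move=> hF; suff H (s : seq 'I_n) : rintble setT (fun t => \sum_(i <- s) F i t) /\
  \int[mu]_t (\sum_(i <- s) F i t) = \sum_(i <- s) \int[mu]_t F i t by exact: H.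
elim: s => [|i s [ih1 ih2]].
  have -> : (fun t => \sum_(i <- [::]) F i t) = cst 0 by apply/funext => t; rewrite big_nil.
  split; first exact: (@integrable0 _ _ _ mu setT).
  by rewrite big_nil Rintegral0.
have e : (fun t => \sum_(j <- i :: s) F j t) = (fun t => F i t + \sum_(j <- s) F j t).
  by apply/funext => t; rewrite big_cons.
rewrite e; split; first exact: rintbleD.
by rewrite RintegralD//; [rewrite big_cons; congr (_ + _)|exact: hF].
Qed.

Lemma weak_eq_lincomb n c (u0 u0' f : 'I_n -> R -> R[i]) :
  (forall i, isLp 2%:E (f i)) -> (forall i, isH1 (u0 i) (u0' i)) ->
  (forall i, weak_eq V (u0 i) (u0' i) (f i)) ->
  isH1 (lincomb c u0) (lincomb c u0') /\
  weak_eq V (lincomb c u0) (lincomb c u0') (lincomb c f).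
Proof.
move=> hf hu W; suff H (s : seq 'I_n) :
    isH1 (fun t => \sum_(i <- s) c i * u0 i t) (fun t => \sum_(i <- s) c i * u0' i t) /\
    (weak_eq V (fun t => \sum_(i <- s) c i * u0 i t) (fun t => \sum_(i <- s) c i * u0' i t)
      (fun t => \sum_(i <- s) c i * f i t) /\ isLp 2%:E (fun t => \sum_(i <- s) c i * f i t)).
  by have [H1 [H2 _]] := H (index_enum 'I_n); split; [exact: H1|exact: H2].
elim: s => [|i s [ih1 [ih2 ih3]]].
  have e (g : 'I_n -> R -> R[i]) : (fun t => \sum_(i <- [::]) c i * g i t) = cst 0.
    by apply/funext => t; rewrite big_nil.
  rewrite !e; split; first exact: isH1_0.
  split; last exact: isLp2_0.
  move=> v v' hv.
  have e0 h : cintegral setT (fun t => (0 : R[i]) * h t) = 0.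
    by rewrite -[RHS](@cintegral0 R setT); apply: eq_cintegral => t _; rewrite mul0r.
  under [X in _ + X = _]eq_cintegral => t _ do rewrite /= mulr0.
  by rewrite !e0 addr0.
have e (g : 'I_n -> R -> R[i]) : (fun t => \sum_(j <- i :: s) c j * g j t) =
    (fun t => c i * g i t + \sum_(j <- s) c j * g j t).
  by apply/funext => t; rewrite big_cons.
rewrite !e; split; first exact: isH1_lin.
by split; [exact: weak_eq_lin|exact: isLp2_lin].
Qed.

Lemma trace_bound n (e w : 'I_n -> R -> R[i]) : orthonormal e ->
  (forall i, HVsub V (kB * kB) (w i) (e i)) ->
  exists (p : 'I_n -> R) (eps : 'I_n -> R[i]), [/\
    forall i, ip (e i) (w i) = (p i)%:C + eps i,
    forall i, B ^+ 2 * normc (ip (e i) (w i)) ^+ 2 <= p i &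
    B ^+ 2 * \sum_(i < n) normc (eps i) <= 1].
Proof.
move=> o hw; have [he _] := o.
have hw2 i : isLp 2%:E (w i) by have [] := HVsub_isLp2 (hw i).
(* Values at single points enter below, so each [w i] is replaced by its H^1 representative [u i]
   together with the weak derivative. *)
have /choice[q hq] i : exists q : (R -> R[i]) * (R -> R[i]), [/\ w i = q.1 %[ae mu],
    isH1 q.1 q.2 & weak_eq V q.1 q.2 (fun t => e i t + kB * kB * w i t)].
  by have [_ [u [u' [h1 _ h2 h3]]]] := hw i; exists (u, u').
pose u i := (q i).1; pose u' i := (q i).2.
have h1 i : w i = u i %[ae mu] by have [] := hq i.
have h2 i : isH1 (u i) (u' i) by have [] := hq i.
have h3 i : weak_eq V (u i) (u' i) (fun t => e i t + kB * kB * w i t) by have [] := hq i.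
have hu i : isLp 2%:E (u i) by have [] := h2 i.
have hu' i : isLp 2%:E (u' i) by have [] := h2 i.
have hew i : ip (e i) (w i) = ip (e i) (u i) by apply: ip_ae => //; exact: ae_eqxx.
pose S x := \sum_(i < n) normc (u i x) ^+ 2.
have S0 x : 0 <= S x by apply: sumr_ge0 => i _; exact: sqr_ge0.
have SB x : B ^+ 3 * S x <= 1.
  (* Duality at the fixed point x: with these coefficients the combination of the [u i] has the
     value S(x) at x, while that of the [e i] has norm sqrt(S(x)). *)
  pose c i := (u i x)^*.
  have hf i : isLp 2%:E (fun t => e i t + kB * kB * w i t) by apply: isLp2D => //;
    exact: isLp2Z.
  have [H1 H2] := weak_eq_lincomb c hf h2 h3.
  have H3 : weak_eq V (lincomb c u) (lincomb c u')
    (fun t => lincomb c e t + kB * kB * lincomb c w t).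
    move: H2; congr weak_eq; apply/funext => t.
    rewrite /lincomb mulr_sumr -big_split /=; apply: eq_bigr => i _; ring.
  have H4 := ae_eq_lincomb c h1.
  have := resolvent_sup (isLp2_lincomb c hw2) (isLp2_lincomb c he) H4 H1 H3 x.
  have -> : normc (lincomb c u x) = S x.
    rewrite -[RHS]ger0_norm// -normcR; congr normc.
    rewrite /lincomb /S rmorph_sum; apply: eq_bigr => i _.
    by rewrite /c mulrC mulJc.
  have -> : L2norm (lincomb c e) = Num.sqrt (S x).
    apply/eqP; rewrite -(@eqrXn2 _ 2)// ?L2norm_ge0 ?sqrtr_ge0// (sqr_sqrtr (S0 x)).
    by rewrite L2norm_lincomb// /S; under eq_bigr do rewrite /c normcJ.
  move=> h; have [S00|S00] := eqVneq (S x) 0; first by rewrite S00 mulr0.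
  have Sp : 0 < S x by rewrite lt_neqAle eq_sym S00 S0.
  have s0 : 0 < Num.sqrt (S x) by rewrite sqrtr_gt0.
  have b0 : 0 < Num.sqrt B by rewrite sqrtr_gt0.
  (* One factor sqrt(S(x)) cancels from B S(x) <= sqrt(S(x)) / sqrt(B); squaring gives the claim. *)
  have h' : B * Num.sqrt (S x) * Num.sqrt B <= 1.
    rewrite -(ler_pM2l s0) mulr1; move: h; rewrite ler_pdivlMr//.
    by rewrite -{1}(sqr_sqrtr (S0 x)); apply: le_trans; rewrite le_eqVlt; apply/orP; left;
      apply/eqP; ring.
  have -> : B ^+ 3 * S x = (B * Num.sqrt (S x) * Num.sqrt B) ^+ 2.
    by rewrite !exprMn !sqr_sqrtr// ?ltW//; ring.
  by rewrite expr_le1// !mulr_ge0// ltW.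
pose eps i := cintegral setT (fun t => V t * (u i t * (u i t)^*)).
have [iV _] := L1norm_V hV.
have mV : cmeas V by have [] := (isLp1P V).1 hV.
have mui i : cmeas (fun t => u i t * (u i t)^*).
  by apply: cmeasM; [exact: isLp2_cmeas|apply: cmeasJ; exact: isLp2_cmeas].
have buu i : exists M, forall t, normc (u i t * (u i t)^*) <= M.
  have [M M0 hM] := isH1_bounded (h2 i); exists (M * M) => t.
  by rewrite normcM normcJ ler_pM ?normc_ge0.
(* [p i] is the form of -d^2/dx^2 + B^2 at [u i]; the B^2 comes from kB^2 = -B^2 after moving that
   term across the equation. *)
exists (fun i => L2norm (u' i) ^+ 2 + B ^+ 2 * L2norm (u i) ^+ 2), eps; split.
- move=> i; rewrite hew.
  have := h3 i _ _ (h2 i).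
  have -> : cintegral setT (fun t => (e i t + kB * kB * w i t) * (u i t)^*) =
    kB * kB * ip (u i) (u i) + ip (e i) (u i).
    rewrite /ip -cintegral_lin//; [|exact: cintbleMJ..].
    apply: cintegral_ae_eq.
    + apply: cmeasM; last by apply: cmeasJ; exact: isLp2_cmeas.
      by apply: isLp2_cmeas; apply: isLp2D => //; exact: isLp2Z.
    + by apply: cmeasD; apply: cmeasM; try exact: cmeas_cst; rewrite //;
      try exact: isLp2_cmeas; apply: cmeasJ; exact: isLp2_cmeas.
    + by apply: (ae_eq_mono (h1 i)) => t ->; ring.
  have -> : cintegral setT (fun t => V t * u i t * (u i t)^*) = eps i.
    by apply: eq_cintegral => t _; rewrite mulrA.
  rewrite -/(ip (u' i) (u' i)) !ip_norm// kB_sqr => h.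
  have -> : ip (e i) (u i) = (L2norm (u' i) ^+ 2)%:C + eps i + (B ^+ 2)%:C * (L2norm
    (u i) ^+ 2)%:C.
    by rewrite h; ring.
  by rewrite rmorphD rmorphM; ring.
- move=> i; rewrite hew.
  (* Since [e i] is a unit vector, |<e_i, u_i>| <= ||u_i||, and the gradient term of [p i] is
     dropped. *)
  have := le_ip (he i) (hu i); rewrite L2norm_orthonormal// mul1r => h.
  apply: (@le_trans _ _ (B ^+ 2 * L2norm (u i) ^+ 2)); last by rewrite lerDr sqr_ge0.
  by rewrite ler_wpM2l ?sqr_ge0// ler_pXn2r ?nnegrE ?normc_ge0 ?L2norm_ge0.
- have i1 i : rintble setT (fun t => normc (V t * (u i t * (u i t)^*))).
    have [M hM] := buu i; apply: rintble_normc => //; first exact: cmeasM.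
    exact: (cintble_V hV (mui i) hM).
  have le1 i : normc (eps i) <= \int[mu]_t normc (V t * (u i t * (u i t)^*)).
    have [M hM] := buu i; apply: le_normc_cintegral => //; first exact: cmeasM.
    exact: (cintble_V hV (mui i) hM).
  have [j1 j2] := Rintegral_sum i1.
  (* The sum is taken inside the integral, where |V| S <= B^(-3) |V| pointwise. *)
  have le2 : \sum_(i < n) normc (eps i) <= \int[mu]_t (B ^- 3 * normc (V t)).
    apply: (@le_trans _ _ (\sum_(i < n) \int[mu]_t normc (V t * (u i t * (u i t)^*)))).
      by apply: ler_sum => i _.
    rewrite -j2; apply: le_Rintegral => //; first exact: rintbleZ.
    move=> t _; rewrite (_ : \sum_(i < n) _ = normc (V t) * S t).
      rewrite mulrC ler_wpM2r ?normc_ge0//.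
      by rewrite -[leRHS]mulr1 ler_pdivlMl ?exprn_gt0.
    by rewrite mulr_sumr; apply: eq_bigr => i _; rewrite !normcM normcJ expr2.
  rewrite RintegralZl// -/(L1norm V) in le2.
  have -> : 1 = B ^+ 2 * (B ^- 3 * B).
    by rewrite mulrCA -exprSr mulVf// expf_neq0// gt_eqF.
  by rewrite ler_wpM2l ?sqr_ge0.
Qed.

End Resolvent.

(** * Root spaces *)

Section TriangularMatrices.
Variables (F : fieldType).

Lemma trig_mulmx n (A B : 'M[F]_n) : is_trig_mx A -> is_trig_mx B ->
  is_trig_mx (A *m B) /\ forall i, (A *m B) i i = A i i * B i i.
Proof.
move=> /is_trig_mxP hA /is_trig_mxP hB; split.
  apply/is_trig_mxP => i j ij; rewrite mxE big1// => k _.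
  have [ik|ki] := ltnP i k; first by rewrite hA ?mul0r.
  by rewrite [B _ _]hB ?mulr0// (leq_ltn_trans ki).
move=> i; rewrite mxE (bigD1 i)//= big1 ?addr0// => k ki.
have [ik|ki'] := ltnP i k; first by rewrite hA ?mul0r.
by rewrite [B _ _]hB ?mulr0// ltn_neqAle ki' andbT; apply: contra ki => /eqP/val_inj ->.
Qed.

Lemma trig_exp n (A : 'M[F]_n) k : is_trig_mx A ->
  is_trig_mx (A ^+ k) /\ forall i, (A ^+ k) i i = A i i ^+ k.
Proof.
move=> hA; elim: k => [|k [ih1 ih2]].
  rewrite expr0; split; first exact: scalar_mx_is_trig.
  by move=> i; rewrite mxE eqxx.
have [h1 h2] := trig_mulmx hA ih1.
rewrite exprS; split; first exact: h1.
by move=> i; rewrite exprS -ih2; exact: h2.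
Qed.

(** Putting 1 at each vanishing diagonal entry makes the matrix invertible, and this correction has
    rank at most the number of such entries. *)
Lemma trig_rank n (A : 'M[F]_n) : is_trig_mx A ->
  (n <= \rank A + #|[pred i | A i i == 0%R]|)%N.
Proof.
move=> /is_trig_mxP hA; pose D : 'M[F]_n := \sum_(i | A i i == 0) delta_mx i i.
have DE i j : D i j = ((i == j) && (A i i == 0))%:R.
  rewrite /D summxE; have [ij|ij] := eqVneq i j; last first.
    rewrite big1// => k _; rewrite mxE; case: eqVneq => //= <-.
    by rewrite eq_sym (negbTE ij).
  rewrite -ij; have [A0|A0] /= := eqVneq (A i i) 0.
    rewrite (bigD1 i (introT eqP A0)) /= mxE eqxx /= big1 ?addr0// => k /andP[_ ki].
    by rewrite mxE eq_sym (negbTE ki).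
  rewrite big1// => k; rewrite mxE => k0; case: eqVneq => //= ik.
  by rewrite ik k0 in A0.
have rD : (\rank D <= #|[pred i | A i i == 0%R]|)%N.
  rewrite -sum1_card /D; elim/big_ind2: _ => //; first by rewrite mxrank0.
    by move=> x a y b xa yb; rewrite (leq_trans (mxrank_add _ _))// leq_add.
  by move=> i _; rewrite mxrank_delta.
have u : A + D \in unitmx.
  have tAD : is_trig_mx (A + D).
    apply/is_trig_mxP => i j ij; rewrite mxE hA// add0r DE.
    by case: eqVneq => // e; rewrite e ltnn in ij.
  rewrite unitmxE (det_trig tAD) unitfE; apply/prodf_neq0 => i _; rewrite mxE DE eqxx /=.
  by have [->|A0] := eqVneq (A i i) 0; rewrite ?add0r ?oner_eq0 ?addr0.
rewrite -[X in (X <= _)%N](mxrank_unit u).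
by rewrite (leq_trans (mxrank_add _ _))// leq_add2l.
Qed.

(** The rows of [U] are independent and killed by (A - mu)^k, so that power has rank at most m - n.
    By [trig_rank] its diagonal has at least n zeros, each at a place where [A] has the entry mu. *)
Lemma trig_count n m (A : 'M[F]_m) (U : 'M[F]_(n, m)) (mu : F) k :
  is_trig_mx A -> row_free U -> U *m (A - mu%:M) ^+ k = 0 ->
  (n <= #|[pred i | A i i == mu]|)%N.
Proof.
move=> tA fU UA.
have tN : is_trig_mx (A - mu%:M).
  apply/is_trig_mxP => i j ij; rewrite !mxE (is_trig_mxP tA)// sub0r.
  by case: eqVneq => [e|_]; [rewrite e ltnn in ij|rewrite mulr0n oppr0].
have [t1 t2] := trig_exp k tN.
have r1 := trig_rank t1; have := mulmx0_rank_max UA.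
rewrite (eqP fU) => r2.
rewrite -(leq_add2r (\rank ((A - mu%:M) ^+ k))) (leq_trans r2)//
  (leq_trans r1)// addnC leq_add2r.
apply: subset_leq_card; apply/fintype.subsetP => i; rewrite !inE t2 expf_eq0 => /andP[_].
by rewrite !mxE eqxx mulr1n subr_eq0.
Qed.

(** [Q] inverts [P], and the coordinates [U] become [U *m Q] in the new basis. *)
Lemma count_similar n m (A P Q : 'M[F]_m) (U : 'M[F]_(n, m)) (mu : F) k :
  P *m Q = 1%:M -> is_trig_mx (P *m A *m Q) -> row_free U ->
  U *m (A - mu%:M) ^+ k = 0 -> (n <= #|[pred i | (P *m A *m Q) i i == mu]|)%N.
Proof.
move=> PQ tA fU UA; have QP := mulmx1C PQ.
have uQ : row_free Q by apply/row_freeP; exists P.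
apply: (trig_count (U := U *m Q) (k := k)) => //.
  by rewrite /row_free mxrankMfree.
have e : P *m A *m Q - mu%:M = P *m (A - mu%:M) *m Q.
  by rewrite mulmxBr mulmxBl mul_mx_scalar -scalemxAl PQ scalemx1.
have ek j : (P *m (A - mu%:M) *m Q) ^+ j = P *m (A - mu%:M) ^+ j *m Q.
  elim: j => [|j ih]; first by rewrite !expr0 mulmx1 PQ.
  rewrite exprS ih -[_ * _]/(_ *m _) !mulmxA exprS.
  rewrite -[X in X *m P](mulmxA) -!mulmxA; congr (_ *m _).
  by rewrite [Q *m (P *m _)]mulmxA QP mul1mx !mulmxA.
by rewrite e ek !mulmxA -(mulmxA U Q) QP mulmx1 UA mul0mx.
Qed.

End TriangularMatrices.

(** * Gram-Schmidt orthonormalization up to null sets *)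

Section GramSchmidt.
Variable (R : realType).
Notation mu := (@lebesgue_measure R).
Implicit Types (f g u v w : R -> R[i]) (a z : R[i]) (s F : seq (R -> R[i])).
Local Notation "z ^*" := (Num.conj z).

Definition in_span n (e : 'I_n -> R -> R[i]) f := exists c, f = lincomb c e %[ae mu].

Lemma in_span_lin n (e : 'I_n -> R -> R[i]) f g a : in_span e f -> in_span e g ->
  in_span e (fun t => a * f t + g t).
Proof.
move=> [c hc] [d hd]; exists (fun i => a * c i + d i).
apply: (ae_eq_mono2 hc hd) => t -> ->; rewrite /lincomb mulr_sumr -big_split /=.
by apply: eq_bigr => i _; ring.
Qed.

Lemma in_span0 n (e : 'I_n -> R -> R[i]) : in_span e (cst 0).
Proof.
exists (fun=> 0); apply: (ae_eq_mono (ae_eqxx (cst (0 : R)))) => t _.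
by rewrite /lincomb big1// => i _; rewrite mul0r.
Qed.

Lemma in_span_coord n (e : 'I_n -> R -> R[i]) f : orthonormal e -> isLp 2%:E f ->
  in_span e f -> f = lincomb (fun i => ip f (e i)) e %[ae mu].
Proof.
move=> o hf [c hc]; have [he _] := o.
rewrite (_ : (fun i => ip f (e i)) = c)//; apply/funext => i.
by rewrite (ip_ae hf (isLp2_lincomb c he) (he i) (he i) hc (ae_eqxx _)) ip_orthonormal.
Qed.

Definition lin_closed (Q : (R -> R[i]) -> Prop) :=
  Q (cst 0) /\ forall a f g, Q f -> Q g -> Q (fun t => a * f t + g t).

Lemma lin_closed_lincomb (Q : (R -> R[i]) -> Prop) n c (f : 'I_n -> R -> R[i]) :
  lin_closed Q -> (forall i, Q (f i)) -> Q (lincomb c f).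
Proof.
move=> [Q0 QL] h; rewrite /lincomb; elim: (index_enum _) => [|i s ih].
  by rewrite (_ : (fun t => _) = cst 0)//; apply/funext => t; rewrite big_nil.
rewrite (_ : (fun t => _) = (fun t => c i * f i t + \sum_(j <- s) c j * f j t)).
  exact: QL.
by apply/funext => t; rewrite big_cons.
Qed.

(** The third clause says that the [e i] come from [F], in the form used later: every property
    stable under linear combinations passes from [F] to the basis. Solvability of (H_V - z0) w = f
    is transferred in this way. *)
Lemma gram_schmidt F : (forall f, f \in F -> isLp 2%:E f) ->
  exists n (e : 'I_n -> R -> R[i]), [/\ orthonormal e,
    forall f, f \in F -> in_span e f &
    forall Q, lin_closed Q -> (forall f, f \in F -> Q f) -> forall i, Q (e i)].
Proof.
elim: F => [_|f F ih hF].
  by exists 0%N, (fun=> cst 0); split => //; [split; case|move=> Q _ _; case].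
have hf : isLp 2%:E f by apply: hF; rewrite mem_head.
have {}ih := ih (fun g gF => hF g (mem_behead (s := f :: F) gF)).
have [n [e [on sp cl]]] := ih; have [he oe] := on.
pose c i := ip f (e i).
pose r := fun t => -1 * lincomb c e t + f t.
have hr : isLp 2%:E r by apply: isLp2_lin => //; exact: isLp2_lincomb.
have ip_r i : ip r (e i) = 0.
  rewrite /r /ip; have -> : (fun t => (-1 * lincomb c e t + f t) * (e i t)^*) =
    (fun t => -1 * (lincomb c e t * (e i t)^*) + f t * (e i t)^*).
    by apply/funext => t; ring.
  rewrite cintegral_lin//; [|apply: cintbleMJ => //; exact: isLp2_lincomb|exact: cintbleMJ].
  by rewrite -/(ip (lincomb c e) (e i)) -/(ip f (e i)) ip_orthonormal// mulN1r addNr.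
(* A residual of norm zero vanishes almost everywhere, so [f] already lies in the span; otherwise
   its normalization becomes a new vector, placed at index 0. *)
have [r0|r0] := eqVneq (L2norm r) 0.
  exists n, e; split => //.
    move=> g; rewrite inE => /predU1P[->|]; last exact: sp.
    exists c; apply: (ae_eq_mono (L2norm_eq0 hr r0)) => t; rewrite /r /= mulN1r addrC.
    by move=> /eqP; rewrite subr_eq0 => /eqP.
  move=> Q QL hQ; apply: cl => // g gF; apply: hQ; exact: mem_behead.
pose b := fun t => (L2norm r)^-1%:C * r t.
have hb : isLp 2%:E b by exact: isLp2Z.
pose e' (i : 'I_n.+1) := if unlift ord0 i is Some j then e j else b.
have e'0 : e' ord0 = b by rewrite /e' unlift_none.
have e'S j : e' (lift ord0 j) = e j by rewrite /e' liftK.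
have lcE d : lincomb d e' = (fun t => d ord0 * b t + lincomb (fun j => d (lift ord0 j)) e t).
  apply/funext => t; rewrite /lincomb big_ord_recl e'0; congr (_ + _).
  by apply: eq_bigr => j _; rewrite e'S.
have ip_b i : ip b (e i) = 0.
  rewrite /ip /b; have -> : (fun t => (L2norm r)^-1%:C * r t * (e i t)^*) =
    (fun t => (L2norm r)^-1%:C * (r t * (e i t)^*)) by apply/funext => t; rewrite mulrA.
  by rewrite cintegralZ -/(ip r (e i)) ?ip_r ?mulr0//; exact: cintbleMJ.
have nb : ip b b = 1.
  have n1 : L2norm b = 1.
    apply/eqP; rewrite -(@eqrXn2 _ 2)// ?L2norm_ge0// L2norm_sqr /b.
    under eq_Rintegral do rewrite normcM normcR exprMn.
    rewrite RintegralZl//; last by case/isLp2P : hr.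
    rewrite -L2norm_sqr expr1n -exprMn ger0_norm ?invr_ge0 ?L2norm_ge0//.
    by rewrite mulVf// expr1n.
  by rewrite ip_norm// n1 expr1n.
exists n.+1, e'; split.
- split.
    by move=> i; case: (unliftP ord0 i) => [j|] ->; rewrite ?e'0 ?e'S.
  move=> i j; case: (unliftP ord0 i) => [i'|] ->; case: (unliftP ord0 j) => [j'|] ->;
    rewrite ?e'0 ?e'S.
  + by rewrite oe (inj_eq (lift_inj)).
  + by rewrite ipC// ip_b rmorph0 eq_sym (negbTE (neq_lift _ _)).
  + by rewrite ip_b (negbTE (neq_lift _ _)).
  + by rewrite nb eqxx.
- move=> g; rewrite inE => /predU1P[->|gF].
    exists (fun i => if unlift ord0 i is Some j then c j else (L2norm r)%:C).
    rewrite lcE; apply: (ae_eq_mono (ae_eqxx (cst (0 : R)))) => t _.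
    rewrite unlift_none /b mulrA -rmorphM/= mulfV// mul1r.
    rewrite (_ : lincomb _ e t = lincomb c e t); first by rewrite /r; ring.
    by apply: eq_bigr => j _; rewrite liftK.
  have [d hd] := sp _ gF.
  exists (fun i => if unlift ord0 i is Some j then d j else 0).
  rewrite lcE; apply: (ae_eq_mono hd) => t ->.
  rewrite unlift_none mul0r add0r.
  by apply: eq_bigr => j _; rewrite liftK.
- move=> Q QL hQ.
  have Qe j : Q (e j) by apply: cl => // g gF; apply: hQ; exact: mem_behead.
  move=> i; case: (unliftP ord0 i) => [j|] ->; rewrite ?e'0 ?e'S//.
  have [Q0 QL'] := QL.
  have Qr : Q r.
    apply: QL'; first exact: lin_closed_lincomb.
    by apply: hQ; rewrite mem_head.
  have := QL' (L2norm r)^-1%:C _ _ Qr Q0.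
  by rewrite (_ : (fun t => _) = b)//; apply/funext => t; rewrite /= addr0.
Qed.

End GramSchmidt.

(** * Jordan chains and the Schur basis of the resolvent *)

Section RootSpaces.
Variables (R : realType) (V : R -> R[i]).
Notation mu := (@lebesgue_measure R).
Implicit Types (f g u v w : R -> R[i]) (a z : R[i]) (s F : seq (R -> R[i])).
Local Notation "z ^*" := (Num.conj z).
Hypothesis hV : isLp 1%:E V.
Local Notation B := (L1norm V).
Hypothesis B0 : 0 < B.
Local Notation z0 := (((0 : R) +i* B) * ((0 : R) +i* B)).

(** Each entry is the image of the previous one under H_V - z, down to a null function. The whole
    list is kept because the span of all its members, not of the first alone, is invariant under the
    resolvent. *)
Fixpoint jordan_chain z s : Prop :=
  if s is c :: s' then
    if s' is c' :: _ then HVsub V z c c' /\ jordan_chain z s'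
    else isLp 2%:E c /\ c = cst 0 %[ae mu]
  else True.

Lemma ker_pow_chain z k u : ker_pow V z k u -> exists s, jordan_chain z (u :: s).
Proof.
elim: k u => [|k ih] u /=; first by move=> h; exists [::].
by move=> [w h /ih[s hs]]; exists (w :: s).
Qed.

Lemma jordan_chain_isLp2 z s : jordan_chain z s -> forall f, f \in s -> isLp 2%:E f.
Proof.
elim: s => [//|c [|c' s] ih] /=.
  by move=> [h _] f; rewrite inE => /eqP ->.
move=> [h hc] f; rewrite inE => /predU1P[->|]; first by have [] := HVsub_isLp2 h.
exact: ih.
Qed.

(* From [(H - z) c = c'] one gets
   [(H - z0)^-1 c = (c - (H - z0)^-1 c') / (z - z0)]. *)
Lemma resolvent_chain z c c' w : z != z0 -> HVsub V z c c' -> HVsub V z0 w c' ->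
  HVsub V z0 (fun t => (z - z0)^-1 * (c t - w t)) c.
Proof.
move=> zz h hw; have z1 : z - z0 != 0 by rewrite subr_eq0.
have H1 := HV_lin hV (-1) hw h.
have H2 := HV_lin hV (z - z0)^-1 H1 (HV_0 V).
move: H2; rewrite /HVsub; congr HV; apply/funext => t /=; [ring|].
set q := (z - z0)^-1; have e : q * (z - z0) = 1 by rewrite mulVf.
have -> : q * (-1 * (c' t + z0 * w t) + (c' t + z * c t)) + 0 =
  q * (z - z0) * c t + z0 * (q * (c t - w t)) by ring.
by rewrite e mul1r.
Qed.

Section OrthonormalBasis.
Variables (n : nat) (e w : 'I_n -> R -> R[i]) (A : 'M[R[i]]_n).
Hypothesis o : orthonormal e.
Hypothesis hw : forall i, HVsub V z0 (w i) (e i).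
Hypothesis hA : forall i, w i = lincomb (A i) e %[ae mu].

(** A row vector, because row i of [A] holds the coordinates of [w i]: the resolvent acts by
    multiplication with [A] on the right. *)
Definition coord f : 'rV[R[i]]_n := \row_i ip f (e i).

Lemma coord_lincomb (a : 'I_n -> R[i]) : coord (lincomb a e) = \row_i a i.
Proof. by apply/rowP => i; rewrite !mxE ip_orthonormal. Qed.

Lemma coord_ae f g : isLp 2%:E f -> isLp 2%:E g -> f = g %[ae mu] -> coord f = coord g.
Proof.
move=> hf hg fg; apply/rowP => i; rewrite !mxE; apply: ip_ae => //; try exact: o.1.
exact: ae_eqxx.
Qed.

Lemma lincomb_coord f : isLp 2%:E f -> in_span e f -> f = lincomb (coord f 0) e %[ae mu].
Proof.
move=> hf sf; have := in_span_coord o hf sf.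
by rewrite (_ : coord f 0 = (fun i => ip f (e i)))//; apply/funext => i; rewrite mxE.
Qed.

Lemma lincomb_resolvent (a : 'rV[R[i]]_n) : lincomb (a 0) w = lincomb ((a *m A) 0) e %[ae mu].
Proof.
apply: (ae_eq_mono (ae_eq_lincomb (a 0) hA)) => t ->; rewrite /lincomb.
transitivity (\sum_(i < n) \sum_(j < n) a 0 i * A i j * e j t).
  by apply: eq_bigr => i _; rewrite mulr_sumr; apply: eq_bigr => j _; rewrite mulrA.
by rewrite exchange_big; apply: eq_bigr => j _; rewrite mxE mulr_suml.
Qed.

(** [resolvent_chain] in coordinates. One preimage of [c] combines the [w i] with the coordinates of
    [c], another comes from the chain; they agree by [resolvent_inj]. *)
Lemma coord_jordan z c c' : z != z0 -> HVsub V z c c' -> in_span e c -> in_span e c' ->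
  coord c *m A = (z - z0)^-1 *: (coord c - coord c' *m A).
Proof.
move=> zz h sc sc'; have [hc hc'] := HVsub_isLp2 h; have [he _] := o.
set q := (z - z0)^-1; set a := coord c; set a' := coord c'.
have hw2 i : isLp 2%:E (w i) by have [] := HVsub_isLp2 (hw i).
have H1 : HVsub V z0 (lincomb (a 0) w) (lincomb (a 0) e) by exact: HVsub_sum.
have H2 : HVsub V z0 (lincomb (a' 0) w) (lincomb (a' 0) e) by exact: HVsub_sum.
have H2' : HVsub V z0 (lincomb (a' 0) w) c'.
  apply: (HVsub_ae H2) => //; [exact: isLp2_lincomb|exact: ae_eqxx|].
  by apply: (ae_eq_mono (lincomb_coord hc' sc')) => t ->.
have H3 := resolvent_chain zz h H2'; rewrite -/q in H3.
have H4 := HVsub_lin hV (-1) H1 H3.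
have H5 : (fun t => -1 * lincomb (a 0) e t + c t) = cst 0 %[ae mu].
  by apply: (ae_eq_mono (lincomb_coord hc sc)) => t <- /=; ring.
(* The difference of the two preimages solves the equation with null right-hand side. *)
have H6 := resolvent_inj hV B0 H4 H5.
have H7 : lincomb ((a *m A) 0) e = lincomb ((q *: (a - a' *m A)) 0) e %[ae mu].
  apply: (ae_eq_mono2 (ae_eq_mono2 H6 (lincomb_resolvent a) (u2 := fun t => q *
    (c t - lincomb (a' 0) w t)) (v2 := lincomb ((a *m A) 0) e) _)
    (ae_eq_mono2 (lincomb_coord hc sc) (lincomb_resolvent a')
      (u2 := fun t => c t - lincomb (a' 0) w t) (v2 := fun t => lincomb
        (a 0) e t - lincomb ((a' *m A) 0) e t) _)).
  - move=> t /= h1 <-; apply/eqP; rewrite -subr_eq0 -h1; apply/eqP; ring.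
  - by move=> t -> ->.
  - move=> t <- ->; rewrite /lincomb -sumrB mulr_sumr; apply: eq_bigr => i _; rewrite !mxE;
    ring.
have := coord_ae (isLp2_lincomb _ he) (isLp2_lincomb _ he) H7.
by rewrite !coord_lincomb => /rowP h8; apply/rowP => i; have := h8 i;
  rewrite ![(\row__ _) _ _]mxE.
Qed.

(** Root vectors of H_V at z are root vectors of its resolvent at 1/(z - z0); the exponent grows by
    one at each step up the chain. *)
Lemma coord_chain z s : z != z0 -> jordan_chain z s -> (forall f, f \in s -> in_span e f) ->
  forall f, f \in s -> exists k, coord f *m (A - (z - z0)^-1%:M) ^+ k = 0.
Proof.
move=> zz; elim: s => [//|c [|c' s] ih].
  move=> /= [hc c0] sp f; rewrite inE => /eqP ->; exists 0%N.
  rewrite (coord_ae hc (isLp2_0 R) c0) expr0 (_ : coord _ = 0) ?mul0mx//.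
  apply/rowP => i; rewrite !mxE.
  transitivity (cintegral setT (cst 0 : R -> R[i])); last exact: cintegral0.
  by apply: eq_cintegral => t _; rewrite /= mul0r.
move=> [h hs] sp f; rewrite inE => /predU1P[->|fs]; last first.
  by apply: (ih hs _ f fs) => g gs; apply: sp; rewrite inE gs orbT.
have [||k hk] := ih hs _ c' _; [by move=> g gs; apply: sp;
  rewrite inE gs orbT|exact: mem_head|].
set q := (z - z0)^-1 in hk *.
have e1 := coord_jordan zz h (sp c (mem_head _ _)) (sp c' (mem_behead (s := c :: _)
  (mem_head _ _))).
rewrite -/q in e1.
set N := A - q%:M in hk *.
(* With q = 1/(z - z0) and N = A - q, c N = -q c' A = -q (c' N + q c'), so c' N^k = 0 implies c
   N^(k+1) = 0. *)
have e2 : coord c *m N = - q *: (coord c' *m N + q *: coord c').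
  rewrite /N !mulmxBr !mul_mx_scalar e1 scalerBr addrAC subrr sub0r subrK.
  by rewrite scaleNr.
exists k.+1; rewrite exprS -[_ * _]/(_ *m _) mulmxA e2 -scalemxAl mulmxDl -!scalemxAl hk
  scaler0 addr0.
by rewrite -mulmxA -[N *m _]/(N * _) -exprS exprSr -[_ * N]/(_ *m N) mulmxA hk mul0mx scaler0.
Qed.

End OrthonormalBasis.

(** Preimages under H_V - z0 are produced from the null end of the chain upwards by
    [resolvent_chain], and they never leave the span. *)
Lemma resolvent_closed z s n (e : 'I_n -> R -> R[i]) : z != z0 -> jordan_chain z s ->
  (forall f, f \in s -> in_span e f) ->
  forall f, f \in s -> exists2 w, HVsub V z0 w f & in_span e w.
Proof.
move=> zz; elim: s => [//|c [|c' s] ih].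
  move=> /= [hc c0] sp f; rewrite inE => /eqP ->; exists (cst 0); last exact: in_span0.
  apply: (HVsub_ae (HVsub_0 V z0)) => //; [exact: isLp2_0|exact: ae_eqxx|].
  by apply: (ae_eq_mono c0) => t ->.
move=> [h hs] sp f; rewrite inE => /predU1P[->|fs]; last first.
  by apply: (ih hs _ f fs) => g gs; apply: sp; rewrite inE gs orbT.
have [||w hw sw] := ih hs _ c' _; [by move=> g gs; apply: sp;
  rewrite inE gs orbT|exact: mem_head|].
exists (fun t => (z - z0)^-1 * (c t - w t)); first exact: resolvent_chain hw.
have := in_span_lin (z - z0)^-1 (in_span_lin (-1) sw (sp c (mem_head _ _))) (in_span0 e).
by congr in_span; apply/funext => t /=; ring.
Qed.

(** The root vectors of all the points of [Z] are treated in one space, so that a single orthonormal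
    basis, and hence a single trace estimate, serves them together. *)
Lemma root_space_basis (Z : seq R[i]) (d : R[i] -> nat)
    (u : forall z, 'I_(d z) -> R -> R[i]) :
  (forall z, z \in Z -> z != z0) ->
  (forall z, z \in Z -> forall i, exists k, ker_pow V z k (u z i)) ->
  (forall z, z \in Z -> lin_indep (u z)) ->
  exists n (e w : 'I_n -> R -> R[i]), [/\ orthonormal e,
    forall i, HVsub V z0 (w i) (e i) &
    forall z, z \in Z -> (d z <= #|[pred i | ip (w i) (e i) == (z - z0)^-1]|)%N].
Proof.
move=> Zz hu iu.
(* One chain for each root vector; outside [Z] the empty list is a dummy value. *)
have /choice[ch hch] (p : {z : R[i] & 'I_(d z)}) : exists s, tag p \in Z ->
    jordan_chain (tag p) (u (tag p) (tagged p) :: s).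
  have [pZ|pZ] := boolP (tag p \in Z); last by exists [::].
  by have [k /ker_pow_chain[s hs]] := hu _ pZ (tagged p); exists s.
pose chn z (i : 'I_(d z)) := u z i :: ch (Tagged (fun z => 'I_(d z)) i).
have hchn z i : z \in Z -> jordan_chain z (chn z i).
  exact: (hch (Tagged (fun z => 'I_(d z)) i)).
pose F := flatten [seq flatten [seq chn z i | i <- enum 'I_(d z)] | z <- Z].
have inF z i f : z \in Z -> f \in chn z i -> f \in F.
  move=> zZ fi; apply/flattenP; exists (flatten [seq chn z i | i <- enum 'I_(d z)]).
    exact: map_f.
  by apply/flattenP; exists (chn z i) => //; apply: map_f; rewrite mem_enum.
have Fin f : f \in F -> exists z i, z \in Z /\ f \in chn z i.
  by move=> /flattenP[_ /mapP[z zZ ->]] /flattenP[_ /mapP[i _ ->]] fi; exists z, i.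
have hF f : f \in F -> isLp 2%:E f.
  by move=> /Fin[z [i [zZ fi]]]; exact: jordan_chain_isLp2 (hchn _ _ zZ) _ fi.
have [n [e [on sp cl]]] := gram_schmidt hF; have [he oe] := on.
(* Membership of the preimage in the span is part of the property handed to the third clause of
   Gram-Schmidt, which makes the span invariant. *)
have Q i : exists2 w, HVsub V z0 w (e i) & in_span e w.
  apply: (cl (fun f => exists2 w, HVsub V z0 w f & in_span e w)).
    split; first by exists (cst 0); [exact: HVsub_0|exact: in_span0].
    move=> a f g [w1 h1 s1] [w2 h2 s2]; exists (fun t => a * w1 t + w2 t).
      exact: HVsub_lin.
    exact: in_span_lin.
  move=> f /Fin[z [j [zZ fj]]]; apply: (resolvent_closed (Zz _ zZ) (hchn _ j zZ)) => // g gj.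
  by apply: sp; exact: inF gj.
have /choice[w hw] i : exists w, HVsub V z0 w (e i) /\ in_span e w.
  by have [w] := Q i; exists w.
have hw1 i : HVsub V z0 (w i) (e i) := (hw i).1.
have hw2 i : isLp 2%:E (w i) by have [] := HVsub_isLp2 (hw1 i).
pose A : 'M[R[i]]_n := \matrix_(i, j) ip (w i) (e j).
have hA i : w i = lincomb (A i) e %[ae mu].
  have := in_span_coord on (hw2 i) (hw i).2.
  by rewrite (_ : A i = (fun j => ip (w i) (e j)))//; apply/funext => j; rewrite mxE.
(* Schur triangularization: a unitary [P] for the family consisting of [A] alone, where the
   commutation condition is trivial. Unitarity keeps the new basis orthonormal. *)
have [|P Pu] := @cotrigonalization R[i] n [:: A].
  by move=> ? ? /=; rewrite !in_cons !orbF => /eqP-> /eqP->.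
rewrite /= andbT /similar_to conjymx// => tA.
set Q' := map_mx _ _ in tA.
have PQ : P *m Q' = 1%:M by exact: unitarymxP.
(* Inner products in the rotated basis are the entries of the conjugated matrix. It is used with [e]
   for orthonormality and with [w] for the diagonal. *)
have ipP (f : 'I_n -> R -> R[i]) i j : (forall i, isLp 2%:E (f i)) ->
    ip (lincomb (P i) f) (lincomb (P j) e) = (P *m (\matrix_(i, j) ip (f i) (e j)) *m Q') i j.
  move=> hf; rewrite ip_lincombl//; last exact: isLp2_lincomb.
  rewrite -mulmxA !mxE; apply: eq_bigr => k _; congr (_ * _).
  rewrite ip_lincombr// mxE; apply: eq_bigr => l _.
  by rewrite !mxE mulrC.
exists n, (fun i => lincomb (P i) e), (fun i => lincomb (P i) w); split.
- split; first by move=> i; exact: isLp2_lincomb.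
  move=> i j; rewrite ipP// (_ : \matrix_(i, j) _ = 1%:M) ?mulmx1 ?PQ ?mxE//.
  by apply/matrixP => k l; rewrite !mxE oe.
- by move=> i; exact: HVsub_sum.
- move=> z zZ; pose U : 'M[R[i]]_(d z, n) := \matrix_(i, j) ip (u z i) (e j).
  have ui i : u z i \in chn z i by exact: mem_head.
  have rU i : row i U = coord e (u z i) by apply/rowP => j; rewrite !mxE.
  have hui i : isLp 2%:E (u z i) by apply: hF; exact: inF (ui i).
  have sui i : in_span e (u z i) by apply: sp; exact: inF (ui i).
  (* A relation between the rows of coordinates is one between the functions [u z i], since these
     lie in the span. *)
  have fU : row_free U.
    rewrite -kermx_eq0; apply/rowV0P => v /sub_kermxP vU.
    have h0 : coord e (lincomb (v 0) (u z)) = 0.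
      rewrite -vU; apply/rowP => j; rewrite !mxE ip_lincombl//.
      by apply: eq_bigr => k _; rewrite mxE.
    have sl : in_span e (lincomb (v 0) (u z)).
      apply: lin_closed_lincomb => //; split; first exact: in_span0.
      by move=> a f g; exact: in_span_lin.
    have := lincomb_coord on (isLp2_lincomb _ hui) sl; rewrite h0 => h1.
    have h2 : (fun t => \sum_(i < d z) v 0 i * u z i t) = cst 0 %[ae mu].
      by apply: (ae_eq_mono h1) => t h; rewrite -[LHS]/(lincomb _ _ t) h /lincomb big1// =>
        i _; rewrite mxE mul0r.
    by apply/rowP => i; rewrite mxE; exact: iu h2 i.
  have /choice[k hk] i : exists k, coord e (u z i) *m (A - (z - z0)^-1%:M) ^+ k = 0.
    apply: (coord_chain on hw1 hA (Zz _ zZ) (hchn _ i zZ)) => // g gi.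
    by apply: sp; exact: inF gi.
  (* The sum of the individual exponents is one exponent that kills all rows at once. *)
  have UA : U *m (A - (z - z0)^-1%:M) ^+ (\sum_i k i) = 0.
    apply/row_matrixP => i; rewrite row_mul rU row0 (bigD1 i)//= exprD -[_ * _]/(_ *m _).
    by rewrite mulmxA hk mul0mx.
  apply: leq_trans (count_similar PQ tA fU UA) _.
  apply: subset_leq_card; apply/fintype.subsetP => i; rewrite !inE => /eqP <-.
  by rewrite ipP.
Qed.

End RootSpaces.

(** * The eigenvalue sum *)

Section EigenvalueSum.
Variables (R : realType) (V : R -> R[i]).
Notation mu := (@lebesgue_measure R).
Local Notation "z ^*" := (Num.conj z).
Local Notation Re := (@complex.Re R).
Local Notation Im := (@complex.Im R).
Hypothesis hV : isLp 1%:E V.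
Local Notation B := (L1norm V).
Local Notation z0 := (((0 : R) +i* B) * ((0 : R) +i* B)).

Lemma dist_Rplus_le (z : R[i]) (t : R) : 0 <= t -> dist_Rplus z <= normc (z - t%:C).
Proof.
move=> t0; apply: ge_inf; last by exists t.
by exists 0 => _ [s _ <-]; exact: normc_ge0.
Qed.

Lemma dist_Rplus_ge0 (z : R[i]) : 0 <= dist_Rplus z.
Proof.
apply: lb_le_inf; first by exists (normc (z - 0%:C)), 0 => //=.
by move=> _ [s _ <-]; exact: normc_ge0.
Qed.

(* [zeta = conj(1 / zeta) |zeta|^2] equals [p |zeta|^2] up to [eps |zeta|^2],
   and [p |zeta|^2 >= B^2]. *)
Lemma dist_Rplus_resolvent (z eps : R[i]) (p : R) : let zeta := z - z0 in
  zeta != 0 -> (zeta^-1)^* = p%:C + eps -> B ^+ 2 * normc (zeta^-1)^* ^+ 2 <= p ->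
  dist_Rplus z <= normc zeta ^+ 2 * normc eps.
Proof.
move=> zeta zn e h.
have n0 : 0 < normc zeta ^+ 2.
  by rewrite exprn_gt0// lt_neqAle normc_ge0 andbT eq_sym normc_eq0.
have h2 : 0 <= p * normc zeta ^+ 2 - B ^+ 2.
  rewrite subr_ge0; move: h; rewrite normcJ normcV exprVn -ler_pdivlMr ?invr_gt0//.
  by rewrite invrK.
apply: (le_trans (dist_Rplus_le z h2)).
have -> : z - (p * normc zeta ^+ 2 - B ^+ 2)%:C = (normc zeta ^+ 2)%:C * eps.
  have -> : z = zeta - (B ^+ 2)%:C by rewrite /zeta kB_sqr; ring.
  have e1 : zeta = (normc zeta ^+ 2)%:C * (zeta^-1)^*.
    by rewrite -mulJc rmorphV ?unitfE//= mulfK// conjC_eq0.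
  by rewrite [X in X - _ - _]e1 e rmorphB rmorphM/=; ring.
by rewrite normcM normcR ger0_norm// ltW.
Qed.

(** The finite form of the estimate: [d z] independent root vectors at each point, weighted by the
    distance. *)
Lemma dist_Rplus_sum (Z : seq R[i]) (d : R[i] -> nat) : uniq Z ->
  (forall z, z \in Z -> exists2 k, 0 < Im k & z = k * k) ->
  (forall z, z \in Z -> Defs.eigenvalue V z) ->
  (forall z, z \in Z -> exists2 u : 'I_(d z) -> R -> R[i],
      (forall i, exists k, ker_pow V z k (u i)) & lin_indep u) ->
  \sum_(z <- Z) (d z)%:R * dist_Rplus z <= 2 * B ^+ 2.
Proof.
move=> uZ kZ eZ rZ; have [_ Bge0] := L1norm_V hV.
(* From 0 < 2|k| <= B: an eigenvalue forces B > 0, and squaring gives the radius B^2/4. *)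
have bound z : z \in Z -> 0 < B /\ normc z <= B ^+ 2 / 4.
  move=> zZ; have [k k0 zk] := kZ _ zZ; have [u u0 hu] := eZ _ zZ.
  rewrite zk in hu *; have h := eigenvalue_bound hV k0 hu u0.
  have nk : 0 < normc k by apply: lt_le_trans k0 (le_trans (ler_norm _) (normr_Im_le _)).
  split; first by apply: lt_le_trans h; rewrite mulr_gt0.
  by rewrite normcM ler_pdivlMr//; nra.
(* The empty sum is set apart because positivity of B is extracted from an eigenvalue; B = 0 falls
   under this case. *)
case: Z => [|z1 Z] in uZ kZ eZ rZ bound *.
  by rewrite big_nil mulr_ge0// sqr_ge0.
have [B0 _] := bound _ (mem_head _ _).
move: (z1 :: Z) uZ kZ eZ rZ bound => {z1}{}Z uZ kZ eZ rZ bound.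
have nz0 : normc z0 = B ^+ 2 by rewrite normcM normc_kB.
have Zz z : z \in Z -> z != z0.
  move=> zZ; apply/eqP => e; have [_] := bound _ zZ; rewrite e nz0.
  by have := exprn_gt0 2 B0; lra.
(* 5/4 = 1/4 + 1, from |z| <= B^2/4 and |z0| = B^2. *)
have zeta_le z : z \in Z -> normc (z - z0) <= 5 / 4 * B ^+ 2.
  move=> zZ; have [_ h] := bound _ zZ; have := le_normcB z z0; rewrite nz0; lra.
have exu z : exists u : 'I_(d z) -> R -> R[i], z \in Z ->
    (forall i, exists k, ker_pow V z k (u i)) /\ lin_indep u.
  have [zZ|zZ] := boolP (z \in Z); last by exists (fun=> cst 0).
  by have [u h1 h2] := rZ _ zZ; exists u.
pose u z := projT1 (cid (exu z)); have hu z := projT2 (cid (exu z)).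
have [n [e [w [on hw cnt]]]] := root_space_basis hV B0 Zz
  (fun z zZ => (hu z zZ).1) (fun z zZ => (hu z zZ).2).
have [p [eps [e1 e2 e3]]] := trace_bound hV B0 on hw.
have he i : isLp 2%:E (e i) by case: on.
have hw2 i : isLp 2%:E (w i) by have [] := HVsub_isLp2 (hw i).
have key z i : z \in Z -> ip (w i) (e i) = (z - z0)^-1 ->
    dist_Rplus z <= (5 / 4 * B ^+ 2) ^+ 2 * normc (eps i).
  move=> zZ h; have zn : z - z0 != 0 by rewrite subr_eq0 Zz.
  have c1 : ip (e i) (w i) = ((z - z0)^-1)^* by rewrite ipC// h.
  have := @dist_Rplus_resolvent z (eps i) (p i) zn; rewrite -c1 => /(_ (e1 i) (e2 i)) h'.
  apply: le_trans h' _; rewrite ler_wpM2r ?normc_ge0//.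
  by rewrite ler_pXn2r ?nnegrE ?normc_ge0 ?zeta_le// !mulr_ge0 ?sqr_ge0.
(* The weight [d z] is replaced by the number of diagonal entries equal to 1/(z - z0), each paid for
   by its own [eps i]. *)
apply: (@le_trans _ _ (\sum_(z <- Z) \sum_(i < n | ip (w i) (e i) == (z - z0)^-1)
    (5 / 4 * B ^+ 2) ^+ 2 * normc (eps i))).
  rewrite big_seq [leRHS]big_seq; apply: ler_sum => z zZ.
  apply: (@le_trans _ _ (\sum_(i < n | ip (w i) (e i) == (z - z0)^-1) dist_Rplus z)).
    rewrite sumr_const -[leRHS]mulr_natl ler_wpM2r ?dist_Rplus_ge0// ler_nat.
    exact: cnt.
  by apply: ler_sum => i /eqP; exact: key.
have -> : \sum_(z <- Z) \sum_(i < n | ip (w i) (e i) == (z - z0)^-1)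
    (5 / 4 * B ^+ 2) ^+ 2 * normc (eps i) =
  \sum_(i < n) \sum_(z <- Z | ip (w i) (e i) == (z - z0)^-1)
    (5 / 4 * B ^+ 2) ^+ 2 * normc (eps i).
  by rewrite [LHS](exchange_big_dep xpredT)//; apply: eq_bigr => i _; apply: eq_bigl => z;
    rewrite andTb.
apply: (@le_trans _ _ (\sum_(i < n) (5 / 4 * B ^+ 2) ^+ 2 * normc (eps i))).
  apply: ler_sum => i _; set c := (5 / 4 * B ^+ 2) ^+ 2 * normc (eps i).
  have c0 : 0 <= c by rewrite mulr_ge0 ?sqr_ge0 ?normc_ge0.
  (* After the exchange of sums, each index i is charged at most once: z is recovered from the
     diagonal entry, and [Z] has no repetitions. *)
  rewrite big_const_seq iter_addr_0 -mulr_natl -[leRHS]mul1r ler_wpM2r//.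
  rewrite lern1; have -> : count (fun z => ip (w i) (e i) == (z - z0)^-1) Z =
      count_mem ((ip (w i) (e i))^-1 + z0) Z.
    apply: eq_count => z /=; rewrite eq_sym -(inj_eq invr_inj) invrK.
    by rewrite subr_eq.
  by rewrite count_uniq_mem// leq_b1.
rewrite -mulr_sumr.
(* The factor 25/16 left in front of B^2 is what the constant 2 absorbs. *)
have -> : (5 / 4 * B ^+ 2) ^+ 2 * \sum_(i < n) normc (eps i) =
  25 / 16 * B ^+ 2 * (B ^+ 2 * \sum_(i < n) normc (eps i)) by field.
have := exprn_gt0 2 B0; set b := B ^+ 2 => b0.
rewrite -[leRHS]mulr1 ler_pM//.
- by rewrite !mulr_ge0// ltW.
- by rewrite mulr_ge0 ?sumr_ge0// => [|i _]; [exact: ltW|exact: normc_ge0].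
- lra.
Qed.

(** A finite supremum of natural numbers is attained, so some independent family of root vectors has
    exactly [alg_mult] members. *)
Lemma alg_mult_nat z : (alg_mult V z < +oo)%E -> exists n, alg_mult V z = n%:R%:E /\
  exists2 u : 'I_n -> R -> R[i], (forall i, exists k, ker_pow V z k (u i)) & lin_indep u.
Proof.
move=> fin.
pose P n := exists2 u : 'I_n -> R -> R[i], (forall i, exists k, ker_pow V z k
  (u i)) & lin_indep u.
have ub n : P n -> (n%:R%:E <= alg_mult V z)%E.
  by move=> Pn; apply: ereal_sup_ubound; exists n.
have P0 : P 0%N by exists (fun=> cst 0) => [[]//|c _ []].
have f0 : alg_mult V z \is a fin_num by rewrite ge0_fin_numE//; exact: ub P0.
pose r := fine (alg_mult V z).
have r0 : 0 <= r by rewrite fine_ge0//; exact: ub P0.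
have bd n : `[< P n >] -> (n <= Num.bound r)%N.
  move=> /asboolP/ub; rewrite -[X in (_ <= X)%E]fineK// lee_fin -/r => h.
  by rewrite -(ler_nat R) (le_trans h)// ltW// archi_boundP.
have ex : exists n, `[< P n >] by exists 0%N; apply/asboolP.
have [n /asboolP Pn nmax] := ex_maxnP ex bd.
exists n; split => //; apply/eqP; rewrite eq_le ub// andbT.
apply: ub_ereal_sup => _ [m Pm <-]; rewrite lee_fin ler_nat; apply: nmax.
exact/asboolP.
Qed.

(** The sum over [S] is a supremum over finite subsets, so a bound uniform in finite lists of
    eigenvalues suffices. *)
Lemma esum_dist_Rplus (S : set R[i]) :
  (forall z, S z -> discrete_eigenvalue V z /\ 0 < Im (sqrtC z)) ->
  (\esum_(z in S) (alg_mult V z * (dist_Rplus z)%:E) <= (2 * B ^+ 2)%:E)%E.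
Proof.
move=> hS; apply: ub_ereal_sup => _ [A [finA AS] <-].
rewrite fsbig_finite//=.
set Z := finmap.enum_fset (fset_set A).
have hA z : z \in Z -> S z.
  by have := in_fset_set finA z; rewrite /Z => + h; rewrite h => /esym/set_mem/AS.
have /choice[d hd] z : exists d : nat, z \in Z ->
    alg_mult V z = d%:R%:E /\
    exists2 u : 'I_d -> R -> R[i], (forall i, exists k, ker_pow V z k (u i)) & lin_indep u.
  have [zA|zA] := boolP (z \in Z); last by exists 0%N.
  have [[_ _ fin] _] := hS _ (hA _ zA).
  by have [n hn] := alg_mult_nat fin; exists n.
rewrite big_seq; under eq_bigr => z zA do rewrite (hd z zA).1 -EFinM.
rewrite -big_seq sumEFin lee_fin; apply: dist_Rplus_sum.
- exact: finmap.fset_uniq.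
(* The momentum k is the square root itself; its positive imaginary part makes the Green kernel
   decay. *)
- by move=> z /hA/hS[_ h]; exists (sqrtC z) => //; rewrite -expr2 sqrtCK.
- by move=> z /hA/hS[[]].
- by move=> z /hd[].
Qed.

End EigenvalueSum.

(** * Translated supports and the L^1 norm of a sum *)

Section Translation.
Variable R : realType.
Notation mu := (@lebesgue_measure R).
Implicit Types f : R -> R[i].

Lemma isLp1_translate f (a : R) : isLp 1%:E f -> isLp 1%:E (translate f a).
Proof.
move=> /isLp1P[mf i]; apply/isLp1P; split.
  exact: cmeas_comp (mu_preserving_meas (mu_preserving_shift (- a))) mf.
exact: (rintble_mu_preserving (mu_preserving_shift (- a)) i).
Qed.

Lemma esupport_translate_sub f (a t : R) : esupport f t -> esupport (translate f a) (t + a).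
Proof.
move=> h U Ut neg; apply: (h ((fun s => s + a) @^-1` U)).
  by have [c _] := mu_preserving_shift a; exact: c.
have := negligible_mu_preserving (mu_preserving_shift a) neg.
by apply: negligibleS => s [Us fs] /=; split => //; rewrite /translate addrK.
Qed.

Lemma esupport_translate f (a : R) :
  esupport (translate f a) = [set s + a | s in esupport f].
Proof.
apply/seteqP; split => t; last by move=> [s fs <-]; exact: esupport_translate_sub.
(* The converse inclusion is the first one applied to the translation back by -a. *)
move=> /(@esupport_translate_sub _ (- a)) h; exists (t - a); last by rewrite subrK.
by move: h; congr esupport; apply/funext => s; rewrite /translate opprK addrK.
Qed.

(** The source of the factor N: the triangle inequality for the integrals, then Cauchy-Schwarz for a
    sum of n terms. *)
Lemma L1norm_sum n (f : 'I_n -> R -> R[i]) : (forall j, isLp 1%:E (f j)) ->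
  isLp 1%:E (fun t => \sum_(j < n) f j t) /\
  L1norm (fun t => \sum_(j < n) f j t) ^+ 2 <= n%:R * \sum_(j < n) L1norm (f j) ^+ 2.
Proof.
move=> hf.
have mf j : cmeas (f j) by have /isLp1P[] := hf j.
have fi j : rintble setT (fun t => normc (f j t)) by have /isLp1P[] := hf j.
have [si se] := Rintegral_sum fi.
have nS t : normc (\sum_(j < n) f j t) <= \sum_(j < n) normc (f j t).
  elim/big_ind2: _ => [|x a y b xa yb|//]; first by rewrite normc0.
  by rewrite (le_trans (le_normcD _ _))// lerD.
have mS : cmeas (fun t => \sum_(j < n) f j t).
  elim: (index_enum _) => [|j s ih].
    rewrite (_ : (fun t => _) = cst 0); first exact: cmeas_cst.
    by apply/funext => t; rewrite big_nil.
  rewrite (_ : (fun t => _) = (fun t => f j t + \sum_(i <- s) f i t)); first exact: cmeasD.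
  by apply/funext => t; rewrite big_cons.
have iS : rintble setT (fun t => normc (\sum_(j < n) f j t)).
  apply: rintble_dom si _ => //; first exact: cmeas_normc.
  by move=> t _; rewrite ger0_norm ?normc_ge0.
split; first exact/isLp1P.
have Lj j : 0 <= L1norm (f j) by apply: Rintegral_ge0 => t _; exact: normc_ge0.
apply: (@le_trans _ _ ((\sum_(j < n) L1norm (f j)) ^+ 2)).
  rewrite ler_pXn2r ?nnegrE ?sumr_ge0//; last first.
    by apply: Rintegral_ge0 => t _; exact: normc_ge0.
  by rewrite /L1norm -se; apply: le_Rintegral.
(* Lagrange's identity: this double sum equals 2 (n s2 - s1^2), so its sign is the Cauchy-Schwarz
   inequality. *)
have sq : 0 <= \sum_(i < n) \sum_(j < n) (L1norm (f i) - L1norm (f j)) ^+ 2.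
  by apply: sumr_ge0 => i _; apply: sumr_ge0 => j _; exact: sqr_ge0.
set s1 := \sum_(j < n) L1norm (f j) in sq *; set s2 := \sum_(j < n) L1norm (f j) ^+ 2 in sq *.
suff : \sum_(i < n) \sum_(j < n) (L1norm (f i) - L1norm (f j)) ^+ 2 = 2 *
  (n%:R * s2 - s1 ^+ 2).
  by move=> e; move: sq; rewrite e; lra.
have e i : \sum_(j < n) (L1norm (f i) - L1norm (f j)) ^+ 2 =
    n%:R * L1norm (f i) ^+ 2 - (2 * s1) * L1norm (f i) + s2.
  transitivity (\sum_(j < n) (L1norm (f i) ^+ 2 - (2 * L1norm (f i)) * L1norm
    (f j) + L1norm (f j) ^+ 2)).
    by apply: eq_bigr => j _; ring.
  by rewrite big_split sumrB /= sumr_const card_ord -mulr_sumr -/s1 -/s2 mulr_natl; ring.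
under eq_bigr do rewrite e.
rewrite big_split sumrB /= sumr_const card_ord -!mulr_sumr -/s1 -/s2 -mulr_natl; ring.
Qed.

End Translation.

Theorem theorem5 (R : realType) :
  exists (C : R) (N0 : nat), 0 < C /\
  forall N : nat, (N0 <= N)%N ->
  forall S : 'I_N -> set R,
  (forall j, S j 0) ->
  (exists y : 'I_N -> R, trivIset setT (fun j => [set s + y j | s in S j])) ->
  forall eta : R, 0 < eta ->
  forall M : R,
  exists x : 'I_N -> R,
  forall W : 'I_N -> R -> R[i],
  (forall j, isLp 1%:E (W j)) ->
  (forall j, esupport (W j) = S j) ->
  l2L1norm W = M ->
  let Vj := fun j => translate (W j) (x j) in
  let V := fun t => \sum_(j < N) Vj j t in
  trivIset setT (fun j => esupport (Vj j)) /\
  (\esum_(z in [set z : R[i] | (discrete_eigenvalue V z /\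
                                (1 + 1) * eta < complex.Im (sqrtC z))%R])
      (alg_mult V z * (dist_Rplus z)%:E)
    <= (C * N%:R * \sum_(j < N) L1norm (Vj j) ^+ 2)%:E)%E.
Proof.
(* The constant 2 is that of [dist_Rplus_sum], and the given separating points [y] serve as [x]. *)
exists 2, 0%N; split => // N _ S S0 [y ty] eta eta0 M; exists y => W hW SW _ Vj V.
split.
  rewrite (_ : (fun j => _) = (fun j => [set s + y j | s in S j]))//.
  by apply/funext => j; rewrite esupport_translate SW.
have hVj j : isLp 1%:E (Vj j) by exact: isLp1_translate.
have [hV hB] := L1norm_sum hVj.
apply: (le_trans (esum_dist_Rplus hV _)).
  (* A positive [eta] turns the threshold into Im sqrt(z) > 0. *)
  by move=> z [hz h]; split => //; rewrite (le_lt_trans _ h)// mulr_ge0// ltW.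
by rewrite lee_fin -mulrA ler_pM2l.
Qed.
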